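(* Let $n>k\ge1$ be coprime integers, $\ell\ge 1$, and $r,s\in\mathbb{Z}$ with $rn=ks+1$. Let $\varepsilon,\lambda_1,\dots,\lambda_\ell,\xi_1,\dots,\xi_{k+1}$ be nonzero complex numbers and set $\eta_1=(-1)^{k-1}\varepsilon^r\prod_{i=1}^{k}\xi_i^{-1}$, $\eta_2=(-1)^{k-1}\varepsilon^r\xi_{k+1}^{-1}\prod_{i=1}^{k-1}\xi_i^{-1}$. Assume: $\lambda_1,\dots,\lambda_\ell,\eta_1,\eta_2\neq 1$; $\lambda_1,\dots,\lambda_\ell\ne\eta_1$; $\xi_i\neq\xi_j$ for $i\ne j$; $\xi_1+\cdots+\xi_k\ne0$; $\xi_1+\cdots+\xi_{k-1}+\xi_{k+1}\ne0$; $\xi_1^k,\dots,\xi_{k+1}^k\ne\varepsilon^r$; $\lambda_1\cdots\lambda_\ell\,\xi_1^\ell\cdots\xi_{k-1}^\ell\,\xi_k^{\ell-1}\,\xi_{k+1}=(-1)^{(k-1)\ell}\varepsilon^{r\ell}$; and $\xi_i^n=\varepsilon^s$ for all $i=1,\dots,k+1$. Then $(\varepsilon;\lambda_1,\dots,\lambda_\ell;\xi_1,\dots,\xi_{k+1};\ell,\dots,\ell,\ell-1,1)$ is the numerical local data of an irreducible rigid Pochhammer local system $\mathcal{L}$ on $\mathbb{C}^2\setminus Y_{n,k,\ell}$ of multiplicity one along the irreducible components of $Y_{n,k,\ell}=\{\prod_{i=1}^\ell(y^k-C_ix^n)=0\}$. Moreover, $\mathcal{L}|_{\mathbb{C}^2\setminus\widetilde{Y}_\bullet}\equiv\mathcal{F}^{\oplus(\ell-1)}\oplus\mathcal{G}$,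 with $\mathcal{F}$ and $\mathcal{G}$ the rigid irreducible Pochhammer local systems of multiplicity one on $\mathbb{C}^2\setminus Y_\bullet$ determined, respectively, by the tuples $(\varepsilon;\eta_1;\xi_1,\dots,\xi_k;1,\dots,1)$ and $(\varepsilon;\eta_2;\xi_1,\dots,\xi_{k-1},\xi_{k+1};1,\dots,1)$.
   Context: Local systems are locally constant sheaves of finite-dimensional complex vector spaces; $\varrho$ denotes monodromy representation. A pseudo-reflection is an invertible matrix $M$ with $\mathrm{codim}\ker(M-\mathbf{I})=1$; its special eigenvalue is $\det M$, always assumed $\ne1$. Curves. Choose $\rho>0$ and nonzero complex numbers $C,C_1,\dots,C_\ell$, with $C_1,\dots,C_\ell$ distinct, such that the fat curve $\widetilde{Y}_\bullet=\{(t^k,\lambda t^n):|\lambda^k-C|\le\rho,\ t\in\mathbb{C}\}$ (disjoint from $\{y=0\}$ away from the origin) contains the curves $Y_i=\{y^k=C_ix^n\}$, $1\le i\le\ell$. Set $Y_0=\{y=0\}$ and $Y_\bullet=\{y^k-Cx^n=0\}$. The inclusion $\mathbb{C}^2\setminus\widetilde{Y}_\bullet\subset\mathbb{C}^2\setminus Y_\bullet$ is a homotopy equivalence, and $\equiv$ means isomorphism after identifying local systems on these two spaces. Turbine and fundamental groups. For closed discs $D_{\rho_1},D_{\rho_2}\subset\mathbb{C}$ centered at $0$, $0<\rho_1\ll\rho_2$ suitable, let $N_\infty=\partial D_{\rho_1}\times D_{\rho_2}$, and let $N_0,\dots,N_\ell\subset\mathrm{int}(N_\infty)$ be disjoint thin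 closed tubular neighbourhoods of the knots $Y_i\cap\partial(D_{\rho_1}\times D_{\rho_2})$. The turbine of $Y_{n,k,\ell}$ is $T_{n,k,\ell}=N_\infty\setminus\bigcup_{i=1}^\ell\mathrm{int}(N_i)$; it contains $T^*_{n,k,\ell}=N_\infty\setminus\bigcup_{i=0}^\ell\mathrm{int}(N_i)$. With $\alpha_i,\beta_i$ the standard meridian and parallel of $\partial N_i$, and $\delta=\alpha_i^n\beta_i^k$, $\omega_i=\alpha_i^s\beta_i^r$ for $i=0,\infty$ (so $\alpha_i=\delta^r\omega_i^{-k}$), $\pi_1(T^*_{n,k,\ell})=\langle\alpha_1,\dots,\alpha_\ell,\omega_0,\omega_\infty:\alpha_1\cdots\alpha_\ell\omega_\infty=\omega_0\rangle\times\langle\delta\rangle$ ($\langle\delta\rangle$ infinite cyclic), $\pi_1(T_{n,k,\ell})$ is its quotient by $\omega_0^k=\delta^r$, and $\pi_1(\mathbb{C}^2\setminus Y_{n,k,\ell})$ is the quotient of $\pi_1(T_{n,k,\ell})$ by $\omega_\infty^n=\delta^s$. $\pi_1(\partial N_\infty)$ is generated by $\omega_\infty,\delta$, and $\pi_1(\partial N_i)$ by $\alpha_i,\delta$ ($1\le i\le\ell$). The curve $Y_\bullet$ is the case $\ell=1$ (with $C_1=C$). Rigidity. A local system on $T_{n,k,\ell}$ is rigid if it is determined, up to isomorphism among local systems on $T_{n,k,\ell}$, by its restrictions to the boundary tori $\partial N_i$, $i\in\{1,\dots,\ell,\infty\}$. A local system on $\mathbb{C}^2\setminus Y_{n,k,\ell}$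 is rigid if its restriction to the turbine $T_{n,k,\ell}$ is rigid. Pochhammer. A local system on $\mathbb{C}^2\setminus Y_{n,k,\ell}$ with fibre $V$ is Pochhammer if, for the free generators $g=\omega_0^{k-1-j}\alpha_i\omega_0^{1-k+j}$ ($0\le j\le k-1$, $1\le i\le\ell$) of the fundamental group of the complement of the curve in a generic line $x=$ const, one has $\dim V=\sum_g\mathrm{codim}\,V^g$ and $\bigcap_gV^g=0$, where $V^g=\ker(\varrho(g)-1)$; it has multiplicity one if all $\mathrm{codim}\,V^g=1$. Numerical local data: $(\varepsilon;\lambda_1,\dots,\lambda_\ell;\xi_1,\dots,\xi_\nu;m_1,\dots,m_\nu)$ means $\varrho(\delta)=\varepsilon\mathbf{I}$; $\varrho(\alpha_i)$ is a pseudo-reflection with special eigenvalue $\lambda_i$; $\varrho(\omega_0)$ is conjugate to $\zeta_1\mathbf{I}_\ell\oplus\cdots\oplus\zeta_k\mathbf{I}_\ell$ with $\zeta_1,\dots,\zeta_k$ the $k$-th roots of $\varepsilon^r$; $\varrho(\omega_\infty)$ is conjugate to $\xi_1\mathbf{I}_{m_1}\oplus\cdots\oplus\xi_\nu\mathbf{I}_{m_\nu}$ with distinct $\xi_j$ (an eigenvalue with multiplicity $0$ is absent). *)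

(* Defs.v *)
From HB Require Import structures.
From mathcomp Require Import all_boot all_order all_algebra.
From mathcomp Require Import reals complex.

Set Implicit Arguments.
Unset Strict Implicit.
Unset Printing Implicit Defensive.

Import GRing.Theory.
Local Open Scope ring_scope.

(* A local system on a connected space X is given here by its monodromy
   representation, i.e. by a representation of pi_1(X) on its fibre.  The
   fundamental groups involved are finitely presented; a presentation is a type
   of generators with a relation between words, and [weq G u v] says that u and
   v represent the same element of the group presented by G.  The groups and the
   maps between them do not depend on the coefficients C_i of the curves
   y^k = C_i x^n, which therefore do not occur. *)

Inductive word (X : Type) : Type :=
| WOne
| WGen of X
| WMul of word X & word X
| WInv of word X.
Arguments WOne {X}.

Definition wpow (X : Type) (w : word X) (z : int) : word X :=
  match z with
  | Posz n => iter n (WMul w) WOne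
  | Negz n => WInv (iter n.+1 (WMul w) WOne)
  end.

Fixpoint wsubst (X Y : Type) (f : X -> word Y) (w : word X) : word Y :=
  match w with
  | WOne => WOne
  | WGen x => f x
  | WMul u v => WMul (wsubst f u) (wsubst f v)
  | WInv u => WInv (wsubst f u)
  end.

Record presentation := Presentation {
  gen : Type;
  rel : word gen -> word gen -> Prop
}.

Inductive weq (G : presentation) : word (gen G) -> word (gen G) -> Prop :=
| weq_rel u v of rel u v : weq u v
| weq_refl u : weq u u
| weq_sym u v of weq u v : weq v u
| weq_trans u v w of weq u v & weq v w : weq u w
| weq_mul u u' v v' of weq u u' & weq v v' : weq (WMul u v) (WMul u' v')
| weq_inv u u' of weq u u' : weq (WInv u) (WInv u')
| weq_mulA u v w : weq (WMul u (WMul v w)) (WMul (WMul u v) w)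
| weq_mul1 u : weq (WMul WOne u) u
| weq_mulV u : weq (WMul (WInv u) u) WOne.

Record group_hom (G H : presentation) := GroupHom {
  hom_gen :> gen G -> word (gen H);
  hom_rel : forall u v, rel u v -> weq (wsubst hom_gen u) (wsubst hom_gen v)
}.

(* Alpha i stands for alpha_(i+1). *)
Inductive cgen (ell : nat) : Type :=
| Alpha of 'I_ell
| Omega0
| Omegaoo
| Delta.
Arguments Omega0 {ell}.
Arguments Omegaoo {ell}.
Arguments Delta {ell}.

Definition alpha_prod (ell : nat) : word (cgen ell) :=
  \big[@WMul _/WOne]_(i < ell) WGen (Alpha i).

Inductive turbine_star_rel (ell : nat) :
  word (cgen ell) -> word (cgen ell) -> Prop :=
| rel_prod : turbine_star_rel (WMul (alpha_prod ell) (WGen Omegaoo))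
                              (WGen Omega0)
| rel_delta x : turbine_star_rel (WMul (WGen Delta) (WGen x))
                                 (WMul (WGen x) (WGen Delta)).

Inductive turbine_rel (k ell : nat) (r : int) :
  word (cgen ell) -> word (cgen ell) -> Prop :=
| turbine_star u v of turbine_star_rel u v : turbine_rel k r u v
| rel_omega0 : turbine_rel k r (wpow (WGen Omega0) k) (wpow (WGen Delta) r).

Inductive complement_rel (n k ell : nat) (r s : int) :
  word (cgen ell) -> word (cgen ell) -> Prop :=
| complement_turbine u v of turbine_rel k r u v : complement_rel n k r s u v
| rel_omegaoo :
    complement_rel n k r s (wpow (WGen Omegaoo) n) (wpow (WGen Delta) s).

(* pi_1 of the turbine T_{n,k,ell} *)
Definition pi1_turbine (k ell : nat) (r : int) : presentation :=
  Presentation (@turbine_rel k ell r).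

(* pi_1 of C^2 \ Y_{n,k,ell}; the curve Y_bullet is the case ell = 1. *)
Definition pi1_complement (n k ell : nat) (r s : int) : presentation :=
  Presentation (@complement_rel n k ell r s).

Inductive tgen : Type := Meridian | Fibre.

Inductive torus_rel : word tgen -> word tgen -> Prop :=
| rel_torus : torus_rel (WMul (WGen Meridian) (WGen Fibre))
                        (WMul (WGen Fibre) (WGen Meridian)).

Definition pi1_torus : presentation := Presentation torus_rel.

Lemma wsubst_id (X : Type) (w : word X) : wsubst (@WGen X) w = w.
Proof. by elim: w => //= [u -> v ->|u ->]. Qed.

Lemma turbine_hom_rel n k ell r s u v :
  rel (p := pi1_turbine k ell r) u v ->
  weq (G := pi1_complement n k ell r s)
    (wsubst (@WGen _) u) (wsubst (@WGen _) v).
Proof.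
by move=> ruv; rewrite !wsubst_id; apply: weq_rel; apply: complement_turbine.
Qed.

Definition turbine_hom n k ell r s :
  group_hom (pi1_turbine k ell r) (pi1_complement n k ell r s) :=
  GroupHom (@turbine_hom_rel n k ell r s).

(* The boundary torus of N_i (Some i) or of N_infty (None). *)
Definition torus_gen (ell : nat) (i : option 'I_ell) (x : tgen) :
    word (cgen ell) :=
  match x with
  | Meridian => WGen (if i is Some j then Alpha j else Omegaoo)
  | Fibre => WGen Delta
  end.

Lemma torus_hom_rel k ell r (i : option 'I_ell) u v :
  rel (p := pi1_torus) u v ->
  weq (G := pi1_turbine k ell r)
    (wsubst (torus_gen i) u) (wsubst (torus_gen i) v).
Proof.
case=> /=; apply: weq_sym; apply: weq_rel; apply: turbine_star.
exact: rel_delta.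
Qed.

Definition torus_hom k ell r (i : option 'I_ell) :
  group_hom pi1_torus (pi1_turbine k ell r) :=
  GroupHom (@torus_hom_rel k ell r i).

(* The complement of the fat curve is included in C^2 \ Y_{n,k,ell} and is
   homotopy equivalent to C^2 \ Y_bullet: a loop around the fat curve is the
   product alpha_1 ... alpha_ell. *)
Definition fat_gen (ell : nat) (x : cgen 1) : word (cgen ell) :=
  match x with
  | Alpha _ => alpha_prod ell
  | Omega0 => WGen Omega0
  | Omegaoo => WGen Omegaoo
  | Delta => WGen Delta
  end.

Lemma weq_mulr1 (G : presentation) (u : word (gen G)) : weq (WMul u WOne) u.
Proof.
have mulrV (v : word (gen G)) : weq (WMul v (WInv v)) WOne.
  apply: weq_trans; first exact: weq_sym (weq_mul1 _).
  apply: weq_trans.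
    exact: weq_mul (weq_sym (weq_mulV (WInv v))) (weq_refl _).
  apply: weq_trans; first exact: weq_sym (weq_mulA _ _ _).
  apply: weq_trans; first exact: weq_mul (weq_refl _) (weq_mulA _ _ _).
  apply: weq_trans.
    exact: weq_mul (weq_refl _) (weq_mul (weq_mulV v) (weq_refl _)).
  apply: weq_trans; first exact: weq_mul (weq_refl _) (weq_mul1 _).
  exact: weq_mulV.
apply: weq_trans; first exact: weq_mul (weq_refl _) (weq_sym (weq_mulV u)).
apply: weq_trans; first exact: weq_mulA.
apply: weq_trans; first exact: weq_mul (mulrV u) (weq_refl _).
exact: weq_mul1.
Qed.

Lemma weq_comm_big (G : presentation) (d : word (gen G)) (I : Type)
    (e : seq I) (F : I -> word (gen G)) :
  (forall i, weq (WMul d (F i)) (WMul (F i) d)) ->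
  weq (WMul d (\big[@WMul _/WOne]_(i <- e) F i))
      (WMul (\big[@WMul _/WOne]_(i <- e) F i) d).
Proof.
move=> dF; elim: e => [|i e IH].
  by rewrite big_nil; apply: weq_trans (weq_mulr1 _) (weq_sym (weq_mul1 _)).
rewrite big_cons; apply: weq_trans; first exact: weq_mulA.
apply: weq_trans; first exact: weq_mul (dF i) (weq_refl _).
apply: weq_trans; first exact: weq_sym (weq_mulA _ _ _).
apply: weq_trans; first exact: weq_mul (weq_refl _) IH.
exact: weq_mulA.
Qed.

Lemma wsubst_wpow (X Y : Type) (f : X -> word Y) (w : word X) (z : int) :
  wsubst f (wpow w z) = wpow (wsubst f w) z.
Proof.
have it m : wsubst f (iter m (WMul w) WOne) = iter m (WMul (wsubst f w)) WOne.
  by elim: m => //= m ->.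
by case: z => m; rewrite /= ?it.
Qed.

Lemma fat_hom_rel n k ell r s u v :
  rel (p := pi1_complement n k 1 r s) u v ->
  weq (G := pi1_complement n k ell r s)
    (wsubst (@fat_gen ell) u) (wsubst (@fat_gen ell) v).
Proof.
have tur w w' : turbine_rel k r w w' ->
    weq (G := pi1_complement n k ell r s) w w'.
  by move=> h; apply: weq_rel; apply: complement_turbine.
have star w w' : turbine_star_rel w w' ->
    weq (G := pi1_complement n k ell r s) w w'.
  by move=> h; apply: tur; apply: turbine_star.
case=> [_ _ [_ _ [|x]|]|].
- rewrite /= /alpha_prod big_ord_recl big_ord0 /=.
  apply: weq_trans (star _ _ (rel_prod _)).
  exact: weq_mul (weq_mulr1 (G := pi1_complement n k ell r s) _) (weq_refl _).
- case: x => [i|||] /=; try by apply: star; apply: rel_delta.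
  apply: (weq_comm_big (G := pi1_complement n k ell r s)) => j.
  by apply: star; apply: rel_delta.
- by rewrite !wsubst_wpow; apply: tur; apply: rel_omega0.
- by rewrite !wsubst_wpow; apply: weq_rel; apply: rel_omegaoo.
Qed.

Definition fat_hom n k ell r s :
  group_hom (pi1_complement n k 1 r s) (pi1_complement n k ell r s) :=
  GroupHom (@fat_hom_rel n k ell r s).

Section LocalSystems.

Variable K : fieldType.

Fixpoint weval (X : Type) (d : nat) (f : X -> 'M[K]_d) (w : word X) : 'M[K]_d :=
  match w with
  | WOne => 1%:M
  | WGen x => f x
  | WMul u v => weval f u *m weval f v
  | WInv u => invmx (weval f u)
  end.

(* The fibre is K^lsdim, matrices acting on column vectors. *)
Record locsys (G : presentation) := LocSys {
  lsdim : nat;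
  lsgen : gen G -> 'M[K]_lsdim;
  lsgen_unit : forall x, lsgen x \in unitmx;
  lsgen_rel : forall u v, rel u v -> weval lsgen u = weval lsgen v
}.

Definition monodromy (G : presentation) (L : locsys G) (w : word (gen G)) :
  'M[K]_(lsdim L) := weval (@lsgen G L) w.

Definition isols (G : presentation) (L M : locsys G) : Prop :=
  exists (P : 'M[K]_(lsdim M, lsdim L)) (Q : 'M[K]_(lsdim L, lsdim M)),
    [/\ P *m Q = 1%:M, Q *m P = 1%:M &
        forall w, P *m monodromy L w = monodromy M w *m P].

Lemma weval_unit (X : Type) d (f : X -> 'M[K]_d) w :
  (forall x, f x \in unitmx) -> weval f w \in unitmx.
Proof.
move=> fU; elim: w => //= [|u hu v hv|u hu]; first exact: unitmx1.
- by rewrite unitmx_mul hu.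
- by rewrite unitmx_inv.
Qed.

Lemma monodromy_weq (G : presentation) (L : locsys G) u v :
  weq u v -> monodromy L u = monodromy L v.
Proof.
rewrite /monodromy; elim=> //=.
- exact: lsgen_rel.
- by move=> ? ? ? _ -> _ ->.
- by move=> ? ? ? ? _ -> _ ->.
- by move=> ? ? _ ->.
- by move=> *; rewrite mulmxA.
- by move=> *; rewrite mul1mx.
- by move=> w; rewrite mulVmx // weval_unit //; apply: lsgen_unit.
Qed.

Lemma weval_subst (X Y : Type) d (f : Y -> 'M[K]_d) (g : X -> word Y) w :
  weval (fun x => weval f (g x)) w = weval f (wsubst g w).
Proof. by elim: w => //= [u -> v ->|u ->]. Qed.

Section Restrict.
Variables (G H : presentation) (phi : group_hom G H) (L : locsys H).

Lemma restrict_unit x : monodromy L (phi x) \in unitmx.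
Proof. by apply: weval_unit; apply: lsgen_unit. Qed.

Lemma restrict_rel u v : rel u v ->
  weval (fun x => monodromy L (phi x)) u =
  weval (fun x => monodromy L (phi x)) v.
Proof.
by move=> ruv; rewrite !weval_subst; apply: monodromy_weq; apply: hom_rel.
Qed.

Definition ls_restrict : locsys G := LocSys restrict_unit restrict_rel.
End Restrict.

Section DirectSum.
Variable G : presentation.

Lemma ls0_rel (u v : word (gen G)) : rel u v ->
  weval (fun _ => 1%:M : 'M[K]_0) u = weval (fun _ => 1%:M : 'M[K]_0) v.
Proof. by move=> _; apply/matrixP; case. Qed.

Definition ls0 : locsys G := LocSys (fun _ => unitmx1 K 0) ls0_rel.

Variables L M : locsys G.

Definition lsadd_gen (x : gen G) : 'M[K]_(lsdim L + lsdim M) :=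
  block_mx (lsgen L x) 0 0 (lsgen M x).

Lemma lsadd_unit x : lsadd_gen x \in unitmx.
Proof.
by rewrite unitmxE det_ublock unitrM -!unitmxE !lsgen_unit.
Qed.

Lemma lsadd_eval w :
  weval lsadd_gen w = block_mx (monodromy L w) 0 0 (monodromy M w).
Proof.
elim: w => //= [|u -> v ->|u ->].
- by rewrite -scalar_mx_block.
- by rewrite mulmx_block !(mulmx0, mul0mx, addr0, add0r).
- rewrite /monodromy /= -/(monodromy L u) -/(monodromy M u).
  have uL : monodromy L u \in unitmx by apply/weval_unit/lsgen_unit.
  have uM : monodromy M u \in unitmx by apply/weval_unit/lsgen_unit.
  set B := block_mx _ _ _ _; set B' := block_mx _ _ _ _.
  have uB : B \in unitmx by rewrite unitmxE det_ublock unitrM -!unitmxE uL.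
  have BB' : B *m B' = 1%:M.
    by rewrite mulmx_block !(mulmx0, mul0mx, addr0, add0r) !mulmxV //
      -scalar_mx_block.
  by rewrite -[RHS](mulKmx uB) BB' mulmx1.
Qed.

Lemma lsadd_rel u v : rel u v -> weval lsadd_gen u = weval lsadd_gen v.
Proof.
by move=> ruv; rewrite !lsadd_eval /monodromy !(lsgen_rel _ ruv).
Qed.

Definition lsadd : locsys G := LocSys lsadd_unit lsadd_rel.
End DirectSum.

Definition lsmuln (G : presentation) (L : locsys G) (m : nat) : locsys G :=
  iter m (lsadd L) (ls0 G).

(* The row space of [fixspace M] is the space of transposes of the column
   vectors v such that M *m v = v; likewise subspaces of the fibre are encoded
   below by the row space of U and acted upon by transposed matrices. *)
Definition fixspace (d : nat) (M : 'M[K]_d) : 'M[K]_d := kermx (M - 1%:M)^T.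

Definition codimfix (d : nat) (M : 'M[K]_d) : nat := (d - \rank (fixspace M))%N.

Definition pseudo_reflection (d : nat) (M : 'M[K]_d) : Prop :=
  [/\ M \in unitmx, codimfix M = 1%N & \det M != 1].

Definition ls_irreducible (G : presentation) (L : locsys G) : Prop :=
  (0 < lsdim L)%N /\
  forall U : 'M[K]_(lsdim L),
    (forall w, stablemx U (monodromy L w)^T) -> U = 0 \/ row_full U.

Definition turbine_rigid (k ell : nat) (r : int)
    (L : locsys (pi1_turbine k ell r)) : Prop :=
  forall L' : locsys (pi1_turbine k ell r),
    (forall i : option 'I_ell,
       isols (ls_restrict (torus_hom k r i) L') (ls_restrict (torus_hom k r i) L)) ->
    isols L' L.

Section Complement.

Variables (n k ell : nat) (r s : int).
Variable L : locsys (pi1_complement n k ell r s).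

Definition ls_rigid : Prop := turbine_rigid (ls_restrict (turbine_hom n k ell r s) L).

(* Generators of the fundamental group of a generic line x = const minus the
   curve. *)
Definition line_gen (j : 'I_k) (i : 'I_ell) : word (cgen ell) :=
  WMul (WMul (wpow (WGen Omega0) (k%:Z - 1 - j%:Z)) (WGen (Alpha i)))
       (wpow (WGen Omega0) (1 - k%:Z + j%:Z)).

Definition pochhammer : Prop :=
  lsdim L = (\sum_(j < k) \sum_(i < ell)
               codimfix (monodromy L (line_gen j i)))%N
  /\ (\bigcap_(j < k) \bigcap_(i < ell)
        fixspace (monodromy L (line_gen j i)))%MS = 0.

Definition multiplicity_one : Prop :=
  forall (j : 'I_k) (i : 'I_ell), codimfix (monodromy L (line_gen j i)) = 1%N.

End Complement.

(* M is conjugate to xi_1 I_{m_1} (+) ... (+) xi_nu I_{m_nu}; the existence of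
   P and Q forces d = m_1 + ... + m_nu. *)
Definition conj_scalars (d nu : nat) (M : 'M[K]_d) (xi : 'I_nu -> K)
    (m : 'I_nu -> nat) : Prop :=
  exists (P : 'M[K]_(d, \sum_(j < nu) m j)) (Q : 'M[K]_(\sum_(j < nu) m j, d)),
    [/\ P *m Q = 1%:M, Q *m P = 1%:M &
        M = P *m (\mxdiag_(j < nu) ((xi j)%:M : 'M[K]_(m j))) *m Q].

Definition local_data (n k ell : nat) (r s : int)
    (L : locsys (pi1_complement n k ell r s)) (eps : K) (lambda : 'I_ell -> K)
    (nu : nat) (xi : 'I_nu -> K) (m : 'I_nu -> nat) : Prop :=
  [/\ monodromy L (WGen Delta) = eps%:M,
      forall i : 'I_ell,
        pseudo_reflection (monodromy L (WGen (Alpha i))) /\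
        \det (monodromy L (WGen (Alpha i))) = lambda i,
      exists zeta : 'I_k -> K,
        [/\ injective zeta, forall j, zeta j ^+ k = eps ^ r &
            conj_scalars (monodromy L (WGen Omega0)) zeta (fun=> ell)],
      injective xi &
      conj_scalars (monodromy L (WGen Omegaoo)) xi m].

End LocalSystems.

(* Main.v *)
(* Write [W0], [Woo], [A_i] for the monodromy of [omega_0], [omega_oo],
   [alpha_i], so that [A_1 ... A_l Woo = W0] and [W0 ^+ k] is scalar.

   Existence.  [F] and [G] are hypergeometric: [W0] and [Woo] are companion
   matrices with prescribed eigenvalues, which differ by a matrix of rank one.
   On [N := F^(l-1) + G] the monodromy around the fat curve is
   [1 + P (D - 1) Q] with [Q P = 1] and [D = diag(eta1, ..., eta1, eta2)] of
   size [l].  Jordan-Pochhammer matrices [B_1, ..., B_l] are pseudo-reflections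
   whose product is conjugate to [D], and [A_i := 1 + P (B_i - 1) Q] refines [N]
   to a local system on the complement of the whole curve.

   Irreducibility.  As [xi_j ^+ k != eps ^ r], the matrices [W0] and [Woo] agree
   on no nonzero stable subspace and no nonzero stable quotient; this reduces
   irreducibility to that of the [B_i], which holds because no coefficient of
   [B_i - 1] on its nonzero row vanishes.  It also gives the condition
   [\bigcap_g V^g = 0].

   Rigidity.  If [L'] has the same restrictions to the boundary tori, Scott's
   lemma applied to [Hom(L, L')] yields a nonzero morphism from [L] to [L'] or
   from [L'] to [L].  The eigenvalue multiplicities of [W0] on [L'] are unknown,
   but do not matter since those on [L] are all equal. *)
Require Import Defs.
From HB Require Import structures.
From mathcomp Require Import all_boot all_order all_algebra.
From mathcomp Require separable cyclotomic.
From mathcomp Require Import reals complex.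
From mathcomp Require Import zify ring.

Set Implicit Arguments.
Unset Strict Implicit.
Unset Printing Implicit Defensive.

Import GRing.Theory Num.Theory.
Local Open Scope ring_scope.
Local Open Scope complex_scope.

(** * Diagonalisable matrices with prescribed eigenvalues and multiplicities *)

Section ConjScalars.

Variable K : fieldType.

(** Eigenspaces of distinct eigenvalues are in direct sum, so their ranks add up to at most [d]. The
    lower bounds [m j] already sum to [d], hence are attained, and stacking bases of the eigenspaces
    gives the conjugating matrix [Q]. *)
Lemma eigen_conj_scalars (d nu : nat) (M : 'M[K]_d) (xi : 'I_nu -> K)
    (m : 'I_nu -> nat) :
  injective xi -> (forall j, m j <= \rank (eigenspace M (xi j)))%N ->
  (\sum_j m j)%N = d -> conj_scalars M xi m.
Proof.
move=> xi_inj m_le m_sum; pose E j := eigenspace M (xi j).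
have Edx : mxdirect (\sum_j E j) by apply: mxdirect_sum_eigenspace => i j _ _;
  apply: xi_inj.
have sumE : (\sum_j \rank (E j))%N = d.
  apply/eqP; rewrite eqn_leq; apply/andP; split.
    by rewrite -(mxdirectP Edx) /= rank_leq_col.
  by rewrite -[X in (X <= _)%N]m_sum leq_sum.
have mE j : \rank (E j) = m j.
  apply/eqP; rewrite eqn_leq m_le andbT leqNgt; apply/negP => lt_j.
  suff: (\sum_j m j < \sum_j \rank (E j))%N by rewrite m_sum sumE ltnn.
  rewrite (bigD1 j) //= [X in (_ < X)%N](bigD1 j) //= -addSn leq_add // leq_sum //.
pose R j : 'M_(m j, d) := castmx (mE j, erefl d) (row_base (E j)).
have RE j : (R j :=: E j)%MS.
  by apply: eqmx_trans (eqmx_cast _ _) (eq_row_base _).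
pose Q := \mxcol_j R j.
have QE : (Q :=: \sum_j E j)%MS.
  apply: eqmx_trans (eqmx_col _) _; apply: eqmx_sums => j _.
  by apply: eqmx_trans (genmxE _) (RE j).
have rkQ : \rank Q = d by rewrite QE (mxdirectP Edx).
have freeQ : row_free Q by rewrite /row_free rkQ m_sum.
have fullQ : row_full Q by rewrite /row_full rkQ.
exists (pinvmx Q), Q; split; [exact: mulVpmx | exact: mulmxVp |].
rewrite -mulmxA mul_mxdiag_mxcol.
have -> : \mxcol_j ((xi j)%:M *m R j) = Q *m M.
  rewrite mxcol_mul; apply: eq_mxcol => j; rewrite mul_scalar_mx; apply/esym/eigenspaceP.
  by rewrite RE.
by rewrite mulmxA mulVpmx // mul1mx.
Qed.

(** The blocks of the conjugating matrices are dual bases of left and right eigenvectors; the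
    [P j *m Q j] are the spectral projections, in which all later computations with such an [M] take
    place. *)
Lemma conj_scalarsE (d nu : nat) (M : 'M[K]_d) (xi : 'I_nu -> K)
    (m : 'I_nu -> nat) :
  conj_scalars M xi m ->
  exists (P : forall j, 'M[K]_(d, m j)) (Q : forall j, 'M[K]_(m j, d)),
    [/\ forall j, Q j *m M = xi j *: Q j, forall j, M *m P j = xi j *: P j,
        forall j, Q j *m P j = 1%:M, forall i j, i != j -> Q i *m P j = 0 &
        \sum_j P j *m Q j = 1%:M].
Proof.
case=> P [Q [PQ QP ME]].
have QM : Q *m M = \mxdiag_j (xi j)%:M *m Q by rewrite ME !mulmxA QP mul1mx.
have MP : M *m P = P *m \mxdiag_j (xi j)%:M by rewrite ME -!mulmxA QP mulmx1.
exists (submxrow P), (submxcol Q).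
move: QM MP PQ QP; rewrite -{1 2 3 4}(submxcolK Q) -{1 2 3 4}(submxrowK P).
rewrite mul_mxdiag_mxcol mul_mxrow_mxdiag mxcol_mul mul_mxrow mul_mxrow_mxcol
  mul_mxcol_mxrow.
move=> /eq_mxcolP QM /eq_mxrowP MP PQ.
rewrite -mxdiagZ /mxdiag => /eq_mxblockP QP; split=> // [j|j|j|i j ij].
- by rewrite QM mul_scalar_mx.
- by rewrite MP mul_mx_scalar.
- by rewrite QP eqxx conform_mx_id.
- by rewrite QP (negPf ij).
Qed.

Lemma mulmx1_dim m n (P : 'M[K]_(m, n)) (Q : 'M[K]_(n, m)) :
  P *m Q = 1%:M -> Q *m P = 1%:M -> m = n.
Proof.
move=> PQ QP; apply/eqP; rewrite eqn_leq.
rewrite -{1}(mxrank1 K m) -PQ (leq_trans (mxrankM_maxl _ _)) ?rank_leq_col //.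
by rewrite -{1}(mxrank1 K n) -QP (leq_trans (mxrankM_maxl _ _)) ?rank_leq_col.
Qed.

Lemma conj_scalars_dim (d nu : nat) (M : 'M[K]_d) (xi : 'I_nu -> K)
    (m : 'I_nu -> nat) : conj_scalars M xi m -> (\sum_j m j)%N = d.
Proof. by case=> P [Q [PQ QP _]]; apply: mulmx1_dim QP PQ. Qed.

Lemma rank_eigenspace_conj_scalars (d nu : nat) (M : 'M[K]_d)
    (xi : 'I_nu -> K) (m : 'I_nu -> nat) j :
  conj_scalars M xi m -> (m j <= \rank (eigenspace M (xi j)))%N.
Proof.
move=> /conj_scalarsE[P [Q [QM _ QP _ _]]].
have -> : m j = \rank (Q j).
  apply/esym/eqP/row_freeP; exists (P j); exact: QP.
by apply/mxrankS/eigenspaceP; rewrite QM.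
Qed.

Lemma conj_scalars_conj (d d' nu : nat) (M : 'M[K]_d) (M' : 'M[K]_d') 
    (xi : 'I_nu -> K) (m : 'I_nu -> nat) 
    (P : 'M_(d', d)) (Q : 'M_(d, d')) :
  P *m Q = 1%:M -> Q *m P = 1%:M -> P *m M = M' *m P ->
  conj_scalars M xi m -> conj_scalars M' xi m.
Proof.
move=> PQ QP PM [S [T [ST TS ME]]]; exists (P *m S), (T *m Q); split.
- by rewrite -mulmxA (mulmxA S) ST mul1mx.
- by rewrite -mulmxA (mulmxA Q) QP mul1mx.
- by rewrite -[M']mulmx1 -PQ mulmxA -PM ME !mulmxA.
Qed.

Lemma conj_scalars_similar (d d' nu : nat) (M : 'M[K]_d) (M' : 'M[K]_d') 
    (xi : 'I_nu -> K) (m : 'I_nu -> nat) :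
  conj_scalars M xi m -> conj_scalars M' xi m ->
  exists (P : 'M_(d', d)) (Q : 'M_(d, d')),
    [/\ P *m Q = 1%:M, Q *m P = 1%:M & P *m M = M' *m P].
Proof.
move=> [P [Q [PQ QP ->]]] [P' [Q' [PQ' QP' ->]]].
exists (P' *m Q), (P *m Q'); split.
- by rewrite -mulmxA (mulmxA Q) QP mul1mx.
- by rewrite -mulmxA (mulmxA Q') QP' mul1mx.
- by rewrite -!mulmxA (mulmxA Q P) QP (mulmxA Q' P') QP' !mul1mx.
Qed.

Lemma conj_scalarsX_unit (d nu : nat) (M : 'M[K]_d) (xi : 'I_nu -> K)
    (m : 'I_nu -> nat) (k : nat) (c : K) :
  conj_scalars M xi m -> (forall j, xi j ^+ k != c) -> M ^+ k - c%:M \in unitmx.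
Proof.
move=> /conj_scalarsE[P [Q [QM MP QP QP0 sumPQ]]] xik.
(* The inverse: the spectral projections weighted by the inverses of the eigenvalues of
   [M ^+ k - c]. *)
pose N := \sum_j (xi j ^+ k - c)^-1 *: (P j *m Q j).
suff /mulmx1_unit[] : (M ^+ k - c%:M) *m N = 1%:M by [].
rewrite mulmx_sumr -sumPQ; apply: eq_bigr => j _.
have MkP : M ^+ k *m P j = xi j ^+ k *: P j.
  elim: (k) => [|i IH]; first by rewrite !expr0 mul1mx scale1r.
  by rewrite exprSr -mulmxE -mulmxA MP -scalemxAr IH scalerA exprS.
rewrite -scalemxAr mulmxA mulmxBl MkP mul_scalar_mx -scalerBl -scalemxAl scalerA.
by rewrite mulVf ?scale1r // subr_eq0.
Qed.

End ConjScalars.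

(** * Two-sided multiplication on spaces of matrices *)

Section Sandwich.

Variable K : fieldType.

(* The matrix of [X |-> A X B] on vectorised matrices. *)
Definition sandwich p d' d q (A : 'M[K]_(p, d')) (B : 'M[K]_(d, q)) :
  'M[K]_(d' * d, p * q) := lin_mulmx A *m lin_mulmxr B.

Lemma mxvec_sandwich p d' d q (A : 'M[K]_(p, d')) (B : 'M[K]_(d, q)) X :
  mxvec X *m sandwich A B = mxvec (A *m X *m B).
Proof. by rewrite mulmxA !mul_vec_lin /=. Qed.

Lemma mxvec_ext m n p (A B : 'M[K]_(m * n, p)) :
  (forall X, mxvec X *m A = mxvec X *m B) -> A = B.
Proof.
move=> AB; apply/row_matrixP => i; rewrite !rowE -(vec_mxK (delta_mx 0 i)).
exact: AB.
Qed.

Lemma sandwichM p p' d' d q q' (A : 'M[K]_(p, d')) (B : 'M[K]_(d, q))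
    (A' : 'M[K]_(p', p)) (B' : 'M[K]_(q, q')) :
  sandwich A B *m sandwich A' B' = sandwich (A' *m A) (B *m B').
Proof. by apply: mxvec_ext => X; rewrite mulmxA !mxvec_sandwich !mulmxA. Qed.

Lemma sandwich1 d' d : sandwich 1%:M 1%:M = 1%:M :> 'M[K]_(d' * d).
Proof. by apply: mxvec_ext => X; rewrite mxvec_sandwich mulmx1 mul1mx mulmx1. Qed.

Lemma sandwich0 p d' d q (B : 'M[K]_(d, q)) : sandwich (0 : 'M_(p, d')) B = 0.
Proof.
by apply: mxvec_ext => X; rewrite mxvec_sandwich !mul0mx mulmx0 linear0.
Qed.

(** The fixed points of [X |-> g'^-1 X g] are the intertwiners [X g = g' X]. They contain the maps
    between eigenspaces of equal eigenvalue, which [E] embeds and [F] recovers, a space of dimension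
    [\sum_j m' j * m j]. *)
Lemma rank_sandwich_sub1 (d d' nu : nat) (g : 'M[K]_d) (g' : 'M[K]_d') 
    (xi : 'I_nu -> K) (m m' : 'I_nu -> nat) :
  g' \in unitmx ->
  conj_scalars g xi m -> conj_scalars g' xi m' ->
  (\rank (sandwich (invmx g') g - 1%:M)%R + \sum_j m' j * m j <= d' * d)%N.
Proof.
move=> g'U /conj_scalarsE[P [Q [Qg _ QP QP0 _]]].
move=> /conj_scalarsE[P' [Q' [_ gP' QP' QP0' _]]].
pose E := \mxcol_j sandwich (P' j) (Q j).
pose F := \mxrow_j sandwich (Q' j) (P j).
have EF : E *m F = 1%:M.
  rewrite mul_mxcol_mxrow -mxdiagZ; apply/eq_mxblockP => i j.
  rewrite sandwichM; case: eqVneq => [<-|ij].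
    by rewrite QP QP' sandwich1 conform_mx_id.
  by rewrite QP0' 1?eq_sym // sandwich0.
have rkE : \rank E = (\sum_j m' j * m j)%N.
  by apply/eqP/row_freeP; exists F.
have ET : E *m (sandwich (invmx g') g - 1%:M) = 0.
  rewrite mulmxBr mulmx1 mxcol_mul; apply/eqP; rewrite subr_eq0; apply/eqP.
  apply: eq_mxcol => j; rewrite sandwichM.
  apply: mxvec_ext => X; rewrite !mxvec_sandwich Qg; congr (mxvec _).
  rewrite -scalemxAr 2!scalemxAl; congr (_ *m _ *m _).
  by rewrite scalemxAr -gP' mulKmx.
rewrite -rkE -leq_subRL ?rank_leq_row // -mxrank_ker.
by apply/mxrankS; rewrite sub_kermx ET.
Qed.

End Sandwich.

(** * Scott's lemma *)

Section Scott.

Variable K : fieldType.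

(* [Z] is the direct sum of the [g - 1], [W] the map [v |-> (v (g - 1))_g],
   whose composition with [H] telescopes to [prod - 1]. *)
Lemma scott_factorization D (gs : seq 'M[K]_D) :
  exists N (W : 'M[K]_(D, N)) (Z : 'M[K]_N) (H : 'M[K]_(N, D)),
  [/\ (W <= Z)%MS /\ \rank Z = (\sum_(g <- gs) \rank (g - 1%:M)%R)%N,
      W *m H = \prod_(g <- gs) g - 1%:M,
      forall m (v : 'M_(m, D)), v *m W = 0 -> {in gs, forall g, v *m g = v} &
      forall m (c : 'M_(D, m)), Z *m (H *m c) = 0 -> {in gs, forall g, g *m c = c}].
Proof.
elim: gs => [|g gs [N [W [Z [H [[WZ rkZ] WH fixW fixZ]]]]]].
  exists 0%N, 0, 0, 0; split=> //; rewrite ?big_nil ?mxrank0 ?sub0mx ?subrr ?mulmx0 //.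
exists (D + N)%N, (row_mx (g - 1%:M) W), (block_mx (g - 1%:M) 0 0 Z).
exists (col_mx (\prod_(g <- gs) g) H); split.
- rewrite rank_diag_block_mx rkZ big_cons; split=> //.
  have /submxP[W0 ->] := WZ; apply/submxP; exists (row_mx 1%:M W0).
  by rewrite mul_row_block !mulmx0 mul1mx addr0 add0r.
- by rewrite mul_row_col WH big_cons -mulmxE mulmxBl mul1mx addrA subrK.
- move=> m v; rewrite mul_mx_row -[0]row_mx0 => /eq_row_mx[vg /fixW vgs] h.
  rewrite inE => /predU1P[->|/vgs //].
  by apply/eqP; move/eqP: vg; rewrite mulmxBr mulmx1 subr_eq0.
- move=> m c; rewrite mul_col_mx mul_block_col !mul0mx addr0 add0r -[0]col_mx0.
  move=> /eq_col_mx[gc /fixZ cgs] h; rewrite inE => /predU1P[->|/cgs //].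
  have prodc : (\prod_(g <- gs) g) *m c = c.
    elim: (gs) cgs => [|f fs IH] cfs; first by rewrite big_nil mul1mx.
    rewrite big_cons -mulmxE -mulmxA IH ?cfs ?mem_head // => f' f'fs.
    by rewrite cfs // inE f'fs orbT.
  by apply/eqP; move/eqP: gc; rewrite prodc mulmxBl mul1mx subr_eq0.
Qed.

(** Without fixed row vectors [W] has rank [D], and its row space lies in that of [Z] and is killed
    by [H], because the product is [1]. Without fixed column vectors [Z *m H] has rank [D] too.
    Rank-nullity for [H] on the row space of [Z] then gives [2 * D <= \rank Z]. *)
Lemma scott D (gs : seq 'M[K]_D) :
  \prod_(g <- gs) g = 1%:M -> (\sum_(g <- gs) \rank (g - 1%:M)%R < 2 * D)%N ->
  (exists2 v : 'rV_D, v != 0 & {in gs, forall g, v *m g = v}) \/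
  (exists2 c : 'cV_D, c != 0 & {in gs, forall g, g *m c = c}).
Proof.
move=> prod1; have [N [W [Z [H [[WZ <-] WH fixW fixZ]]]]] := scott_factorization gs.
rewrite {}prod1 subrr in WH; move=> rk_lt.
have [/eqP kW|/rowV0Pn[v /sub_kermxP vW v0]] := eqVneq (kermx W) 0; last first.
  by left; exists v => //; apply: fixW.
have [/eqP kZ|/rowV0Pn[c /sub_kermxP cZ c0]] := eqVneq (kermx (Z *m H)^T) 0; last first.
  right; exists c^T; first by rewrite trmx_eq0.
  by apply: fixZ; rewrite mulmxA; apply: trmx_inj; rewrite trmx_mul trmxK cZ trmx0.
suff: (2 * D <= \rank Z)%N by rewrite leqNgt rk_lt.
rewrite -(mxrank_mul_ker Z H) mul2n -addnn leq_add //.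
  by rewrite -mxrank_tr; move: kZ; rewrite kermx_eq0 => /eqP->.
move: kW; rewrite kermx_eq0 => /eqP kW; rewrite -[X in (X <= _)%N]kW.
by apply/mxrankS; rewrite sub_capmx WZ; apply/sub_kermxP.
Qed.

End Scott.

(** * Scott's lemma on spaces of homomorphisms *)

Section Intertwiner.

Variable K : fieldType.

Lemma invmxM d (A B : 'M[K]_d) : A \in unitmx -> B \in unitmx ->
  invmx (A *m B) = invmx B *m invmx A.
Proof.
move=> uA uB; have uAB : A *m B \in unitmx by rewrite unitmx_mul uA.
by rewrite -[RHS]mul1mx -(mulVmx uAB) -!mulmxA mulKVmx // mulmxV // mulmx1.
Qed.

(** Scott's lemma for the action [X |-> g.2^-1 X g.1]. A fixed row vector is an intertwiner [X]; a
    fixed column vector is an invariant linear form, which the trace pairing turns into an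
    intertwiner in the opposite direction. *)
Lemma scott_intertwiner d d' (gs : seq ('M[K]_d * 'M[K]_d')) :
  (forall g, g \in gs -> g.2 \in unitmx) ->
  \prod_(g <- gs) g.1 = 1%:M -> \prod_(g <- gs) g.2 = 1%:M ->
  (\sum_(g <- gs) \rank (sandwich (invmx g.2) g.1 - 1%:M)%R < 2 * (d' * d))%N ->
  (exists2 X : 'M_(d', d), X != 0 & forall g, g \in gs -> X *m g.1 = g.2 *m X) \/
  (exists2 Y : 'M_(d, d'), Y != 0 & forall g, g \in gs -> g.1 *m Y = Y *m g.2).
Proof.
move=> gsU prod1 prod2 rk_lt.
pose S (g : 'M[K]_d * 'M[K]_d') := sandwich (invmx g.2) g.1.
have prodS : \prod_(g <- map S gs) g = 1%:M.
  rewrite big_map.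
  suff [] : \prod_(g <- gs) S g =
    sandwich (invmx (\prod_(g <- gs) g.2)) (\prod_(g <- gs) g.1) /\
    \prod_(g <- gs) g.2 \in unitmx.
    by rewrite prod1 prod2 invmx1 sandwich1.
  elim: (gs) gsU => [|g s IH] sU.
    by rewrite !big_nil unitmx1 invmx1 sandwich1.
  have sU' f : f \in s -> f.2 \in unitmx by move=> fs; rewrite sU // inE fs orbT.
  have [IH1 IH2] := IH sU'.
  rewrite !big_cons -!mulmxE unitmx_mul IH2 sU ?mem_head //; split=> //.
  by rewrite IH1 sandwichM invmxM // sU ?mem_head.
have [||[v v0 vS]|[c c0 cS]] := @scott _ _ (map S gs) => //; first by rewrite big_map.
- left; exists (vec_mx v) => [|g ggs]; first by rewrite vec_mx_eq0.
  have := vS _ (map_f S ggs); rewrite -{1}(vec_mxK v) mxvec_sandwich.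
  by move=> /(congr1 vec_mx); rewrite !mxvecK => {2}<-; rewrite -mulmxA mulKVmx ?gsU.
- right; pose Y := vec_mx c^T; have cE : c = (mxvec Y)^T by rewrite vec_mxK trmxK.
  exists Y^T => [|g ggs]; first by rewrite trmx_eq0 vec_mx_eq0 trmx_eq0.
  have gU := gsU _ ggs; have := cS _ (map_f S ggs); rewrite cE => cSg.
  suff : (invmx g.2)^T *m Y *m g.1^T = Y.
    move=> /(congr1 trmx); rewrite !trmx_mul !trmxK => {2}<-.
    by rewrite !mulmxA mulmxKV.
  (* Entries are pairings with matrices of rank one, so the invariance of the linear form can be
     tested on them. *)
  have entry (A : 'M[K]_(d', d)) i j : A i j = ((delta_mx 0 i : 'rV_d') *m A *m (delta_mx
    0 j : 'rV_d)^T) 0 0.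
    by rewrite trmx_delta -rowE -colE !mxE.
  apply/matrixP => i j; rewrite 2!entry -(mxvec_dotmul Y) -[in RHS]cSg (mulmxA (mxvec _)).
  rewrite mxvec_sandwich -[in RHS](trmxK (invmx _)) [in RHS]mulmxA -trmx_mul
    -[in RHS]mulmxA.
  by rewrite mxvec_dotmul trmx_mul !mulmxA.
Qed.

End Intertwiner.

(** * Morphisms of local systems and Schur's lemma *)

Section LocalSystemTools.

Variable K : fieldType.

Lemma intertwine_gen (G : presentation) (L M : locsys K G)
    (P : 'M[K]_(lsdim M, lsdim L)) :
  (forall x, P *m lsgen L x = lsgen M x *m P) ->
  forall w, P *m monodromy L w = monodromy M w *m P.
Proof.
move=> Pgen; rewrite /monodromy; elim=> [|x|u IHu v IHv|u IHu] /=.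
- by rewrite mulmx1 mul1mx.
- exact: Pgen.
- by rewrite mulmxA IHu -mulmxA IHv mulmxA.
- have uL : weval (lsgen L) u \in unitmx by apply/weval_unit/lsgen_unit.
  have uM : weval (lsgen M) u \in unitmx by apply/weval_unit/lsgen_unit.
  by rewrite -[P *m _](mulKmx uM) (mulmxA _ P) -IHu -mulmxA mulmxV // mulmx1.
Qed.

Lemma isols_sym (G : presentation) (L M : locsys K G) : isols L M -> isols M L.
Proof.
case=> P [Q [PQ QP int]]; exists Q, P; split=> // w.
by rewrite -[LHS]mulmx1 -PQ mulmxA -(mulmxA Q) -int !mulmxA QP mul1mx.
Qed.

Lemma isols_dim (G : presentation) (L M : locsys K G) :
  isols L M -> lsdim L = lsdim M.
Proof. by case=> P [Q [PQ QP _]]; apply: mulmx1_dim QP PQ. Qed.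

(* Schur: a nonzero map from or to an irreducible representation of the same
   dimension is bijective. *)
Lemma isols_of_irreducible (G : presentation) (L M : locsys K G)
    (Y : 'M[K]_(lsdim L, lsdim M)) :
  ls_irreducible L -> lsdim M = lsdim L -> Y != 0 ->
  (forall w, monodromy L w *m Y = Y *m monodromy M w) -> isols M L.
Proof.
move=> [_ irrL] dimML Y0 intY.
have [w|/eqP|fullU] := irrL <<Y^T>>%MS.
- rewrite genmxE (eqmxMr _ (genmxE _)) -trmx_mul intY trmx_mul; exact: submxMl.
- by rewrite -submx0 genmxE submx0 trmx_eq0 (negPf Y0).
have rkY : \rank Y = lsdim L.
  by apply/eqP; move: fullU; rewrite /row_full genmxE mxrank_tr.
exists Y, (pinvmx Y); split => //.
  by rewrite mulmxVp // /row_free rkY.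
by rewrite mulVpmx // /row_full rkY dimML.
Qed.

Lemma isols_from_irreducible (G : presentation) (L M : locsys K G)
    (X : 'M[K]_(lsdim M, lsdim L)) :
  ls_irreducible L -> lsdim M = lsdim L -> X != 0 ->
  (forall w, X *m monodromy L w = monodromy M w *m X) -> isols M L.
Proof.
move=> [_ irrL] dimML X0 intX.
have [w|/eqP|fullU] := irrL (kermx X^T).
- apply/sub_kermxP; rewrite -mulmxA -trmx_mul intX trmx_mul mulmxA.
  by rewrite mulmx_ker mul0mx.
- rewrite kermx_eq0 /row_free mxrank_tr => /eqP rkX.
  have XV : X *m pinvmx X = 1%:M by rewrite mulmxVp // /row_free rkX dimML.
  have VX : pinvmx X *m X = 1%:M by rewrite mulVpmx // /row_full rkX.
  exists (pinvmx X), X; split => // w.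
  by rewrite -[LHS]mulmx1 -XV !mulmxA -(mulmxA _ _ X) -intX !mulmxA VX mul1mx.
- have := submx_full 1%:M fullU; rewrite sub_kermx mul1mx trmx_eq0.
  by rewrite (negPf X0).
Qed.

End LocalSystemTools.

(** * Roots of scalar matrices and pseudo-reflections *)

Section RootsOfScalar.

Variable K : fieldType.

Lemma prod_XsubC_roots (k : nat) (zeta : 'I_k -> K) (c : K) :
  (0 < k)%N -> injective zeta -> (forall j, zeta j ^+ k = c) ->
  \prod_j ('X - (zeta j)%:P) = 'X^k - c%:P.
Proof.
move=> k0 zinj zk; rewrite (@all_roots_prod_XsubC _ ('X^k - c%:P) [seq zeta j | j <- enum
  'I_k]).
- rewrite (monicP _) ?monicXnsubC // scale1r big_map big_enum //.
- by rewrite size_XnsubC // size_map size_enum_ord.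
- by apply/allP => _ /mapP[j _ ->]; rewrite rootE !hornerE zk subrr.
- by rewrite uniq_rootsE map_inj_uniq // enum_uniq.
Qed.

(** [M] is annihilated by ['X^k - c], which splits with simple roots. The multiplicities stay
    unspecified: for a local system with the same restrictions to the boundary tori nothing more is
    known about [omega_0]. *)
Lemma root_conj_scalars (d k : nat) (zeta : 'I_k -> K) (c : K) (M : 'M[K]_d) :
  (0 < k)%N -> injective zeta -> (forall j, zeta j ^+ k = c) -> M ^+ k = c%:M ->
  conj_scalars M zeta (fun j => \rank (eigenspace M (zeta j))).
Proof.
move=> k0 zinj zk Mk; apply: eigen_conj_scalars => //.
case: d M Mk => [|d] M Mk.
  by rewrite big1 // => j _; apply/eqP; rewrite -leqn0 rank_leq_row.
rewrite -[LHS]/(\sum_(j | true) _)%N.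
have dx : mxdirect (\sum_(j | true) eigenspace M (zeta j)).
  by apply: mxdirect_sum_eigenspace => i j _ _; apply: zinj.
rewrite -(mxdirectP dx) /=.
under eq_bigr do rewrite eigenspace_poly.
rewrite -kermxpoly_prod => [|i j _ _ ij]; last first.
  by apply: coprimep_XsubC2; rewrite subr_eq0; apply: contra_neq ij => /zinj.
rewrite (prod_XsubC_roots k0 zinj zk) /kermxpoly rmorphB /= rmorphXn /= horner_mx_X.
by rewrite horner_mx_C Mk subrr kermx0 mxrank1.
Qed.

(** Sylvester's identity, from two block triangular factorisations of the same [M]. *)
Lemma det_1D_mulC m n (P : 'M[K]_(m, n)) (Q : 'M[K]_(n, m)) :
  \det (1%:M + P *m Q) = \det (1%:M + Q *m P).
Proof.
pose M := block_mx 1%:M Q (- P) 1%:M.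
have -> : \det (1%:M + P *m Q) = \det M.
  have -> : M = block_mx 1%:M 0 (- P) 1%:M *m block_mx 1%:M Q 0 (1%:M + P *m Q).
    by rewrite mulmx_block !(mulmx1, mul1mx, mulmx0, mul0mx, addr0, add0r) mulNmx addrC
      addrK.
  by rewrite det_mulmx det_lblock det_ublock !det1 !mul1r.
have -> : M = block_mx 1%:M Q 0 1%:M *m block_mx (1%:M + Q *m P) 0 (- P) 1%:M.
  by rewrite mulmx_block !(mulmx1, mul1mx, mulmx0, mul0mx, addr0, add0r) mulmxN addrK.
by rewrite det_mulmx det_lblock det_ublock !det1 !mulr1 mul1r.
Qed.

Lemma rank_factor m n r (X : 'M[K]_(m, n)) : \rank X = r ->
  exists (P : 'M_(m, r)) (Q : 'M_(r, n)), X = P *m Q.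
Proof. by move=> <-; exists (col_base X), (row_base X); rewrite mulmx_base. Qed.

Lemma codimfixE d (M : 'M[K]_d) : codimfix M = \rank (M - 1%:M)%R.
Proof. by rewrite /codimfix /fixspace mxrank_ker mxrank_tr subKn ?rank_leq_row. Qed.

(** Writing [M = 1 + P *m Q] with [Q] a row, [Q] is an eigenvector with eigenvalue [1 + Q *m P],
    which is [\det M] by Sylvester's identity. As it differs from [1], [M] is diagonalisable and its
    conjugacy class depends only on [d] and [\det M]. *)
Lemma pseudo_reflection_conj_scalars d (M : 'M[K]_d) :
  pseudo_reflection M ->
  conj_scalars M (fun j : 'I_2 => if j == 0 then 1 else \det M)
                 (fun j : 'I_2 => if j == 0 then d.-1 else 1%N).
Proof.
case=> MU; rewrite codimfixE => rkM detM.
have d0 : (0 < d)%N by rewrite -rkM rank_leq_row.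
have ord2 (j : 'I_2) : j != 0 -> j = 1 by case: j => [[|[|]]] //= h _; apply: val_inj.
apply: eigen_conj_scalars => [i j|j|].
- case: eqP => [->|/eqP /ord2 ->]; case: eqP => [->|/eqP /ord2 ->] //= h.
    by case/eqP: detM.
  by case/eqP: detM.
- case: eqP => _.
    by rewrite /eigenspace mxrank_ker rkM subn1.
  have [P [Q ME]] := rank_factor rkM.
  rewrite lt0n mxrank_eq0; apply/rowV0Pn; exists Q; last first.
    by apply/eqP => Q0; move: rkM; rewrite ME Q0 mulmx0 mxrank0.
  have MD : M = 1%:M + P *m Q by rewrite -ME addrC subrK.
  apply/eigenspaceP; rewrite {2}MD det_1D_mulC det_mx11 {1}MD.
  by rewrite mulmxDr mulmx1 mulmxA (mx11_scalar (Q *m P)) mul_scalar_mx !mxE eqxx mulr1n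
    scalerDl scale1r.
- by rewrite big_ord_recl big_ord1 /= addn1 prednK.
Qed.

End RootsOfScalar.

(** * Evaluation of products and powers of words *)

Section WordEvaluation.

Variables (K : fieldType) (X : Type) (d : nat) (f : X -> 'M[K]_d).

Lemma weval_prod (I : Type) (e : seq I) (F : I -> word X) :
  weval f (\big[@WMul _/WOne]_(i <- e) F i) = \prod_(i <- e) weval f (F i).
Proof. by elim: e => [|i e IH]; rewrite ?big_nil ?big_cons //= IH. Qed.

Lemma weval_iter (w : word X) m : weval f (iter m (WMul w) WOne) = weval f w ^+ m.
Proof. by elim: m => [|m IH] //=; rewrite IH exprS. Qed.

Lemma weval_wpow_nat (w : word X) (m : nat) : weval f (wpow w m) = weval f w ^+ m.
Proof. exact: weval_iter. Qed.

Lemma scalar_mxX (c : K) m : (c%:M : 'M_d) ^+ m = (c ^+ m)%:M.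
Proof.
elim: m => [|m IH]; first by rewrite !expr0.
by rewrite !exprS IH -mulmxE -scalar_mxM.
Qed.

Lemma weval_wpow_scalar (w : word X) (c : K) (z : int) :
  weval f w = c%:M -> weval f (wpow w z) = (c ^ z)%:M.
Proof.
move=> wc; case: z => m; first by rewrite weval_wpow_nat wc scalar_mxX.
rewrite -[LHS]/(invmx (weval f (iter m.+1 (WMul w) WOne))) weval_iter wc scalar_mxX.
by rewrite invmx_scalar.
Qed.

End WordEvaluation.

(** * Rigidity from local data *)

Section Rigidity.

Variable K : fieldType.

(** If [S] is the map on the right, the one on the left is its inverse, and
    [S^-1 - 1 = - S^-1 (S - 1)]. This serves for [omega_0], which enters the relation through its
    inverse. *)
Lemma rank_sandwich_inv_sub1 d d' (g : 'M[K]_d) (g' : 'M[K]_d') :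
  g \in unitmx -> g' \in unitmx ->
  (\rank (sandwich g' (invmx g) - 1%:M)%R <= \rank (sandwich (invmx g') g - 1%:M)%R)%N.
Proof.
move=> gU gU'.
have -> : sandwich g' (invmx g) - 1%:M =
    - sandwich g' (invmx g) *m (sandwich (invmx g') g - 1%:M).
  by rewrite mulmxBr mulNmx sandwichM mulVmx ?mulmx1 // mulVmx // sandwich1 opprK addrC.
exact: mxrankM_maxr.
Qed.

Variables (n k ell : nat) (r s : int).

Lemma turbine_relations (L : locsys K (pi1_turbine k ell r)) :
  (\prod_(i < ell) lsgen L (Alpha i)) *m lsgen L Omegaoo = lsgen L Omega0 /\
  (forall c, lsgen L Delta = c%:M -> lsgen L Omega0 ^+ k = (c ^ r)%:M).
Proof.
split=> [|c Lc].
  by have := lsgen_rel L (turbine_star k r (rel_prod ell)); rewrite /= weval_prod.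
have := lsgen_rel L (@rel_omega0 k ell r); rewrite weval_wpow_nat => ->.
exact: weval_wpow_scalar.
Qed.

Lemma isols_torus_conj (L L' : locsys K (pi1_turbine k ell r)) i :
  isols (ls_restrict (torus_hom k r i) L') (ls_restrict (torus_hom k r i) L) ->
  exists (P : 'M[K]_(lsdim L', lsdim L)) (Q : 'M[K]_(lsdim L, lsdim L')),
  [/\ P *m Q = 1%:M, Q *m P = 1%:M &
    forall x, P *m monodromy L (torus_gen i x) = monodromy L' (torus_gen i x) *m P].
Proof.
move=> /isols_sym[P [Q [PQ QP int]]]; exists P, Q; split=> // x.
exact: (int (WGen x)).
Qed.

(** With [d = k * ell], the ranks in Scott's lemma are at most [2 * d - 2] for each [alpha_i],
    [d * d - \sum_j m j * m j] for [omega_oo] and [d * d - d * ell] for [omega_0]. The numerical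
    hypothesis says that these bounds add up to less than [2 * d * d]. *)
Theorem rigid_of_local_data (L : locsys K (pi1_complement n k ell r s))
    (eps : K) (lambda : 'I_ell -> K) (nu : nat) (xi : 'I_nu -> K) (m : 'I_nu -> nat) :
  (0 < k)%N -> local_data L eps lambda xi m -> ls_irreducible L ->
  (k * (ell * ell) < \sum_j m j * m j + 2 * ell)%N -> ls_rigid L.
Proof.
move=> k0 [Ldelta Lalpha [zeta [zinj zk L0]] _ Loo] irrL ineq L' torL.
set LT := ls_restrict _ L.
have irrLT : ls_irreducible LT by [].
have dimL : lsdim LT = (k * ell)%N.
  by rewrite -(conj_scalars_dim L0) sum_nat_const card_ord.
have [Poo [Qoo [PQoo QPoo intoo]]] := isols_torus_conj (torL None).
have dimL' : lsdim L' = lsdim LT by apply: isols_dim (torL None).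
have L'delta : lsgen L' Delta = eps%:M.
  have := intoo Fibre; rewrite /= [monodromy LT _]Ldelta mul_mx_scalar => /(congr1
    (mulmx^~ Qoo)).
  by rewrite -mulmxA PQoo mulmx1 -scalemxAl PQoo scalemx1; apply: esym.
have L'oo : conj_scalars (lsgen L' Omegaoo) xi m.
  exact: conj_scalars_conj PQoo QPoo (intoo Meridian) Loo.
have L'0 : conj_scalars (lsgen L' Omega0) zeta (fun j => \rank (eigenspace (lsgen L'
  Omega0) (zeta j))).
  by apply: root_conj_scalars zinj zk _ => //; apply: (turbine_relations L').2.
(* The factors of the relation [alpha_1 ... alpha_ell omega_oo omega_0^-1 = 1], in order; [delta] is
   scalar and commutes with every map. *)
pose gs := [seq (lsgen LT (Alpha i), lsgen L' (Alpha i)) | i <- index_enum 'I_ell] ++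
  [:: (lsgen LT Omegaoo, lsgen L' Omegaoo); (invmx (lsgen LT Omega0), invmx (lsgen L'
    Omega0))].
have gsU g : g \in gs -> g.2 \in unitmx.
  rewrite mem_cat => /orP[/mapP[i _ ->]|]; first exact: lsgen_unit.
  by rewrite !inE => /orP[] /eqP-> /=; rewrite ?unitmx_inv lsgen_unit.
have gs1 : \prod_(g <- gs) g.1 = 1%:M.
  rewrite big_cat big_map big_cons big_seq1 /= -!mulmxE mulmxA (turbine_relations LT).1.
  by rewrite mulmxV // lsgen_unit.
have gs2 : \prod_(g <- gs) g.2 = 1%:M.
  rewrite big_cat big_map big_cons big_seq1 /= -!mulmxE mulmxA (turbine_relations L').1.
  by rewrite mulmxV // lsgen_unit.
have rkA i : (\rank (sandwich (invmx (lsgen L' (Alpha i))) (lsgen LT (Alpha i)) - 1%:M)%R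
    + ((lsdim LT).-1 * (lsdim LT).-1 + 1) <= lsdim L' * lsdim LT)%N.
  have [[Pi [Qi [PQi QPi inti]]] [psi _]] := (isols_torus_conj (torL (Some i)), Lalpha i).
  have cs := pseudo_reflection_conj_scalars psi.
  have cs' := conj_scalars_conj PQi QPi (inti Meridian) cs.
  have := rank_sandwich_sub1 (lsgen_unit L' _) cs cs'.
  by rewrite big_ord_recl big_ord1.
have rkoo := rank_sandwich_sub1 (lsgen_unit L' Omegaoo) Loo L'oo.
have rk0 : (\rank (sandwich (invmx (invmx (lsgen L' Omega0))) (invmx (lsgen LT Omega0)) -
  1%:M)%R
    + lsdim L' * ell <= lsdim L' * lsdim LT)%N.
  rewrite invmxK; have := rank_sandwich_sub1 (lsgen_unit L' _) L0 L'0.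
  rewrite -big_distrl (conj_scalars_dim L'0) /=; apply: leq_trans.
  by rewrite leq_add2r rank_sandwich_inv_sub1 ?lsgen_unit.
have sumA := leq_sum (index_enum 'I_ell) (P := xpredT) (fun i _ => rkA i).
rewrite big_split !sum_nat_const !card_ord /= in sumA.
have rk_lt : (\sum_(g <- gs) \rank (sandwich (invmx g.2) g.1 - 1%:M)%R <
    2 * (lsdim L' * lsdim LT))%N.
  rewrite big_cat big_map big_cons big_seq1 /=.
  move: sumA rkoo rk0.
  set a := (\sum_(i < ell) _)%N; set b := \rank _; set c := \rank _.
  rewrite -[lsdim L]/(lsdim LT) dimL' dimL; set S := (\sum_j m j * m j)%N in ineq *.
  have : (0 < k * ell)%N by rewrite -dimL; case: irrL.
  case: (k * ell)%N (mulnA k ell ell) => // e kll _ /=; nia.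
have [] := scott_intertwiner gsU gs1 gs2 rk_lt.
- case=> X X0 intX; apply: isols_from_irreducible irrLT dimL' X0 _.
  apply: intertwine_gen; case=> [i|||].
  + by apply: (intX (_, _)); rewrite mem_cat map_f // mem_index_enum.
  + have /(intX (_, _)) /= h : (invmx (lsgen LT Omega0), invmx (lsgen L' Omega0)) \in gs.
      by rewrite mem_cat !inE eqxx !orbT.
    have u := lsgen_unit LT Omega0; have u' := lsgen_unit L' Omega0.
    by rewrite -[LHS](mulKVmx u') (mulmxA _ X) -h -!mulmxA mulVmx // mulmx1.
  + by apply: (intX (_, _)); rewrite mem_cat !inE eqxx !orbT.
  + by rewrite L'delta [lsgen LT _]Ldelta mul_mx_scalar mul_scalar_mx.
- case=> Y Y0 intY; apply: isols_of_irreducible irrLT dimL' Y0 _ => w.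
  apply/esym; move: w; apply: intertwine_gen; case=> [i|||].
  + by apply/esym/(intY (_, _)); rewrite mem_cat map_f // mem_index_enum.
  + have /(intY (_, _)) /= h : (invmx (lsgen LT Omega0), invmx (lsgen L' Omega0)) \in gs.
      by rewrite mem_cat !inE eqxx !orbT.
    have u := lsgen_unit LT Omega0; have u' := lsgen_unit L' Omega0.
    by rewrite -[LHS](mulKVmx u) (mulmxA _ Y) h -!mulmxA mulVmx // mulmx1.
  + by apply/esym/(intY (_, _)); rewrite mem_cat !inE eqxx !orbT.
  + by rewrite L'delta [lsgen LT _]Ldelta mul_mx_scalar mul_scalar_mx.
Qed.

End Rigidity.

(** * Uniqueness from local data, and irreducibility *)

Section Irreducibility.

Variable K : fieldType.

(** On each boundary torus [delta] acts as the scalar [eps], so only the conjugacy class of the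
    meridian matters, and the local data prescribe it. *)
Lemma isols_of_local_data (n k ell : nat) (r s : int)
    (L L' : locsys K (pi1_complement n k ell r s)) (eps : K) (lambda : 'I_ell -> K)
    (nu : nat) (xi : 'I_nu -> K) (m : 'I_nu -> nat) :
  ls_rigid L -> local_data L eps lambda xi m -> local_data L' eps lambda xi m ->
  isols L' L.
Proof.
move=> rigL [Ld La _ _ Loo] [L'd L'a _ _ L'oo].
suff [P [Q [PQ QP int]]] : isols (ls_restrict (turbine_hom n k ell r s) L')
                (ls_restrict (turbine_hom n k ell r s) L).
  by exists P, Q; split=> // w; apply: int w.
apply: rigL => i.
suff [P [Q [PQ QP int]]] : exists (P : 'M_(lsdim L, lsdim L')) (Q : 'M_(lsdim L', lsdim L)),
    [/\ P *m Q = 1%:M, Q *m P = 1%:M &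
    P *m monodromy L' (torus_gen i Meridian) = monodromy L (torus_gen i Meridian) *m P].
  exists P, Q; split=> //; apply: intertwine_gen; case=> //=;
    rewrite [X in _ *m X = _]L'd [X in _ = X *m _]Ld.
  by rewrite mul_mx_scalar mul_scalar_mx.
case: i => [i|]; last first.
  by have [P [Q [PQ QP int]]] := conj_scalars_similar L'oo Loo; exists P, Q.
have [[/pseudo_reflection_conj_scalars + dL] [/pseudo_reflection_conj_scalars + dL']] :=
  (La i, L'a i).
rewrite dL dL' => cs.
have -> : (lsdim L').-1 = (lsdim L).-1.
  by rewrite -(conj_scalars_dim Loo) -(conj_scalars_dim L'oo).
by move=> cs'; have [P [Q [PQ QP int]]] := conj_scalars_similar cs' cs; exists P, Q.
Qed.

(* On [U] both [k]-th powers equal [c], while [W ^+ k - c] is invertible. *)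
Lemma stable_agree_eq0 d (U W0 W : 'M[K]_d) (k : nat) (c : K) :
  (U *m W0 <= U)%MS -> U *m W = U *m W0 ->
  W0 ^+ k = c%:M -> W ^+ k - c%:M \in unitmx -> U = 0.
Proof.
move=> /submxP[X UX] UW W0k Wk.
have UX0 i : U *m W0 ^+ i = X ^+ i *m U.
  elim: i => [|i IH]; first by rewrite mulmx1 mul1mx.
  by rewrite !exprSr -!mulmxE mulmxA IH -mulmxA UX mulmxA.
have UXi i : U *m W ^+ i = X ^+ i *m U.
  elim: i => [|i IH]; first by rewrite mulmx1 mul1mx.
  by rewrite !exprSr -!mulmxE mulmxA IH -mulmxA UW UX mulmxA.
by rewrite -[U](mulmxK Wk) mulmxBr UXi -UX0 W0k subrr mul0mx.
Qed.

Lemma trmxX d (A : 'M[K]_d) i : (A ^+ i)^T = A^T ^+ i.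
Proof.
elim: i => [|i IH]; first by rewrite !expr0 trmx1.
by rewrite exprS exprSr -!mulmxE trmx_mul IH.
Qed.

Lemma scalarX_unit_tr d (W : 'M[K]_d) k (c : K) :
  W ^+ k - c%:M \in unitmx -> W^T ^+ k - c%:M \in unitmx.
Proof. by move=> h; rewrite -trmxX -(tr_scalar_mx _ c) -linearB unitmx_tr. Qed.

Lemma prod_1D_factor d m (I : Type) (e : seq I) (P : 'M[K]_(d, m)) (Y : I -> 'M[K]_(m, d)) :
  exists Z, \prod_(i <- e) (1%:M + P *m Y i) = 1%:M + P *m Z.
Proof.
elim: e => [|i e [Z IH]]; first by exists 0; rewrite big_nil mulmx0 addr0.
exists (Z + Y i + Y i *m (P *m Z)); rewrite big_cons IH -mulmxE mulmxDl !mulmxDr !mul1mx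
  mulmx1.
by rewrite !addrA !mulmxA.
Qed.

Lemma prod_fix d p (I : Type) (e : seq I) (X : 'M[K]_(d, p)) (A : I -> 'M[K]_d) :
  (forall i, A i *m X = X) -> (\prod_(i <- e) A i) *m X = X.
Proof.
move=> AX; elim: e => [|i e IH]; first by rewrite big_nil mul1mx.
by rewrite big_cons -mulmxE -mulmxA IH.
Qed.

Lemma complement_relations (n k ell : nat) (r s : int)
    (L : locsys K (pi1_complement n k ell r s)) (c : K) :
  lsgen L Delta = c%:M ->
  (\prod_(i < ell) lsgen L (Alpha i)) *m lsgen L Omegaoo = lsgen L Omega0 /\
  lsgen L Omega0 ^+ k = (c ^ r)%:M.
Proof.
have [LT1 LT2] := turbine_relations (ls_restrict (turbine_hom n k ell r s) L).
by move=> Lc; split; [exact: LT1 | exact: LT2].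
Qed.

(** The preimage of a stable [U] under [P^T] is stable under the transposed [B i]. If it is zero,
    the [alpha_i] fix [U] pointwise; if it is everything, they act trivially on the quotient by [U].
    Either way [omega_0] and [omega_oo] agree there, and [stable_agree_eq0] applies. *)
Lemma irreducible_of_factorization (n k ell : nat) (r s : int)
    (L : locsys K (pi1_complement n k ell r s)) (m : nat)
    (P : 'M[K]_(lsdim L, m)) (Q : 'M[K]_(m, lsdim L)) 
    (B : 'I_ell -> 'M[K]_m) (eps : K) :
  (0 < m)%N -> Q *m P = 1%:M ->
  (forall i, lsgen L (Alpha i) = 1%:M + P *m (B i - 1%:M) *m Q) ->
  (forall U : 'M_m, (forall i, U *m (B i)^T <= U)%MS -> U = 0 \/ row_full U) ->
  lsgen L Delta = eps%:M ->
  lsgen L Omegaoo ^+ k - (eps ^ r)%:M \in unitmx ->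
  ls_irreducible L.
Proof.
move=> m0 QP AE irrB Ldelta Wk.
have [rel_prod W0k] := complement_relations Ldelta.
set A := fun i => lsgen L (Alpha i); set W := lsgen L Omegaoo in Wk rel_prod.
set W0 := lsgen L Omega0 in rel_prod W0k.
split=> [|U Ustab].
  apply: leq_trans m0 _; rewrite -[m in (m <= _)%N](mxrank1 K) -QP.
  by apply: leq_trans (mxrankM_maxl _ _) (rank_leq_col _).
have UA i : (U *m (A i)^T <= U)%MS := Ustab (WGen (Alpha i)).
have UW : (U *m W^T <= U)%MS := Ustab (WGen Omegaoo).
have UW0 : (U *m W0^T <= U)%MS := Ustab (WGen Omega0).
have PA i : P^T *m (A i)^T = (B i)^T *m P^T.
  rewrite -!trmx_mul /A AE mulmxDl mul1mx -!mulmxA QP mulmx1 mulmxBr mulmx1.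
  by rewrite addrC subrK.
have [i||fullE] := irrB (kermx (P^T *m cokermx U)).
- have kP : (kermx (P^T *m cokermx U) *m P^T <= U)%MS.
    by rewrite submxE -mulmxA mulmx_ker.
  rewrite sub_kermx -mulmxA (mulmxA _ P^T) -PA -(mulmxA P^T) (mulmxA _ P^T) (mulmxA _ (A
    i)^T).
  by rewrite -submxE (submx_trans _ (UA i)) ?submxMr.
- move=> kE; left.
  have AU i : A i *m U^T = U^T.
    have AT : (A i)^T = 1%:M + Q^T *m (B i - 1%:M)^T *m P^T.
      by rewrite /A AE [LHS]linearD /= trmx1 !trmx_mul mulmxA.
    have TP : (U *m (Q^T *m (B i - 1%:M)^T) *m P^T <= U)%MS.
      have -> : U *m (Q^T *m (B i - 1%:M)^T) *m P^T = U *m (A i)^T - U.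
        by rewrite AT mulmxDr mulmx1 !mulmxA addrAC subrr add0r.
      by rewrite addmx_sub ?eqmx_opp.
    have T0 : U *m (Q^T *m (B i - 1%:M)^T) = 0.
      by apply/eqP; rewrite -submx0 -kE sub_kermx mulmxA -submxE.
    apply: trmx_inj; rewrite trmx_mul trmxK AT.
    by rewrite mulmxDr mulmx1 mulmxA T0 mul0mx addr0.
  apply: (stable_agree_eq0 (W := W^T)) UW0 _ _ (scalarX_unit_tr Wk).
    apply: trmx_inj; rewrite !trmx_mul !trmxK -rel_prod.
    have [X UX] := submxP UW; have WU : W *m U^T = U^T *m X^T.
      by rewrite -trmx_mul -UX trmx_mul trmxK.
    rewrite -mulmxA WU.
    by rewrite mulmxA prod_fix.
  by rewrite -trmxX W0k tr_scalar_mx.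
- right.
  (* Dual to the previous case, on the annihilator of [U]. *)
  have PU : (P^T <= U)%MS.
    by rewrite submxE -[_ *m _]mul1mx -sub_kermx submx_full.
  suff /eqP : kermx U^T = 0.
    by rewrite kermx_eq0 /row_free mxrank_tr.
  apply: (stable_agree_eq0 (W := W)) _ _ W0k Wk.
    have [X UX] := submxP UW0.
    have -> : W0 = (W0^T)^T by rewrite trmxK.
    rewrite sub_kermx -mulmxA -trmx_mul UX trmx_mul mulmxA mulmx_ker mul0mx //.
  have kP : kermx U^T *m P = 0.
    by have [X PX] := submxP PU; rewrite -[P]trmxK PX trmx_mul mulmxA mulmx_ker mul0mx.
  have [Z ZE] := prod_1D_factor (index_enum 'I_ell) P (fun i => (B i - 1%:M) *m Q).
  rewrite -rel_prod (eq_bigr (fun i => 1%:M + P *m ((B i - 1%:M) *m Q))) => [|i _];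
    last first.
    by rewrite mulmxA; apply: AE.
  by rewrite ZE !mulmxA mulmxDr mulmx1 mulmxA kP mul0mx addr0.
Qed.

End Irreducibility.

(** * The Pochhammer condition *)

Section PochhammerCondition.

Variables (K : fieldType) (n k ell : nat) (r s : int).
Variables (L : locsys K (pi1_complement n k ell r s)) (eps : K).
Hypotheses (eps0 : eps != 0) (Ldelta : lsgen L Delta = eps%:M).

Let W0 := lsgen L Omega0.

Lemma monodromy_line_gen (j : 'I_k) (i : 'I_ell) :
  monodromy L (line_gen j i) =
  W0 ^+ (k.-1 - j) *m lsgen L (Alpha i) *m invmx (W0 ^+ (k.-1 - j)).
Proof.
rewrite /monodromy /line_gen [weval _ _]/=.
have -> : (k%:Z - 1 - j%:Z) = (k.-1 - j)%N%:Z by have := ltn_ord j; lia.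
have -> : (1 - k%:Z + j%:Z) = - (k.-1 - j)%N%:Z by have := ltn_ord j; lia.
rewrite weval_wpow_nat; congr (_ *m _).
case: (k.-1 - j)%N => [|a]; first by rewrite expr0 invmx1.
by rewrite -[LHS]/(invmx (weval (lsgen L) (iter a.+1 (WMul (WGen Omega0)) WOne)))
  weval_iter.
Qed.

Lemma codimfix_line_gen (j : 'I_k) (i : 'I_ell) :
  codimfix (monodromy L (line_gen j i)) = codimfix (lsgen L (Alpha i)).
Proof.
rewrite monodromy_line_gen !codimfixE; set V := W0 ^+ _.
have VU : V \in unitmx.
  by rewrite /V -(weval_wpow_nat (lsgen L) (WGen Omega0)) weval_unit //; apply: lsgen_unit.
have -> : V *m lsgen L (Alpha i) *m invmx V - 1%:M = V *m (lsgen L (Alpha i) - 1%:M) *m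
  invmx V.
  by rewrite mulmxBr mulmxBl mulmx1 mulmxV.
by rewrite mxrankMfree ?row_free_unit ?unitmx_inv // -mxrank_tr trmx_mul mxrankMfree
  ?mxrank_tr // row_free_unit unitmx_tr.
Qed.

(** The generators are conjugates of the [alpha_i] by [W0 ^+ a] with [a < k], so each [alpha_i]
    fixes [W0^-a v] for [v] in the common fixed space. As [W0 ^+ k] is scalar, it fixes all
    [W0 ^+ b v]; the fixed space is thus [W0]-stable, [omega_oo] agrees with [omega_0] on it, and it
    vanishes. *)
Lemma pochhammer_of_codimfix :
  (0 < k)%N -> lsdim L = (k * ell)%N ->
  (forall i, codimfix (lsgen L (Alpha i)) = 1%N) ->
  lsgen L Omegaoo ^+ k - (eps ^ r)%:M \in unitmx ->
  pochhammer L /\ multiplicity_one L.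
Proof.
move=> k0 dimL cA Wk; have mult1 : multiplicity_one L by move=> j i;
  rewrite codimfix_line_gen.
split=> //; split.
  rewrite [LHS]dimL; apply/esym; rewrite (eq_bigr (fun=> ell)) ?sum_nat_const ?card_ord //
    => j _.
  by rewrite (eq_bigr (fun=> 1%N)) ?sum1_card ?card_ord // => i _; apply: mult1.
have [rel_prod W0k] := complement_relations Ldelta; rewrite -/W0 in rel_prod W0k.
set c := eps ^ r in Wk W0k; have c0 : c != 0 by rewrite expfz_neq0.
have W0U : W0 \in unitmx := lsgen_unit L Omega0.
set U := (\bigcap_(j < k) _)%MS.
have fixP m (X : 'M_(m, lsdim L)) (M : 'M_(lsdim L)) :
    (X <= fixspace M)%MS <-> M *m X^T = X^T.
  rewrite /fixspace sub_kermx -trmx_eq0 trmx_mul trmxK mulmxBl mul1mx subr_eq0.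
  by split=> /eqP.
have VU a : W0 ^+ a \in unitmx.
  by rewrite -(weval_wpow_nat (lsgen L) (WGen Omega0)) weval_unit //; apply: lsgen_unit.
have W0D a b (X : 'M_(lsdim L)) : W0 ^+ (a + b) *m X = W0 ^+ a *m (W0 ^+ b *m X).
  by rewrite exprD -mulmxE mulmxA.
have VK a (X : 'M_(lsdim L)) : (a <= k)%N -> invmx (W0 ^+ a) *m X = c^-1 *: (W0 ^+ (k - a)
  *m X).
  move=> ak; rewrite -[RHS](mulKmx (VU a)) -scalemxAr -W0D subnKC // W0k.
  by rewrite mul_scalar_mx scalerA mulVf // scale1r.
have fixUk i b : (b < k)%N -> lsgen L (Alpha i) *m (W0 ^+ b *m U^T) = W0 ^+ b *m U^T.
  have fixV a : (a < k)%N -> lsgen L (Alpha i) *m (invmx (W0 ^+ a) *m U^T) = invmx (W0 ^+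
    a) *m U^T.
    move=> ak; have jk : (k.-1 - a < k)%N by lia.
    have /fixP : (U <= fixspace (monodromy L (line_gen (Ordinal jk) i)))%MS.
      by apply: (bigcapmx_inf (Ordinal jk)) => //; apply: (bigcapmx_inf i).
    rewrite monodromy_line_gen /= (_ : (k.-1 - (k.-1 - a))%N = a); last by lia.
    by move=> {2}<-; rewrite -!mulmxA mulKmx.
  (* Up to a scalar [W0 ^+ b] is the inverse of [W0 ^+ (k - b)]; [b = 0] is separate because [k - b]
     must be below [k]. *)
  case: b => [|b] bk; first by have := fixV 0%N k0; rewrite expr0 invmx1 mul1mx.
  have akb : (k - b.+1 < k)%N by lia.
  have := fixV _ akb; rewrite VK ?leq_subr // subKn 1?ltnW // -scalemxAr.
  by apply: scalerI; rewrite invr_eq0.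
have fixU i b : lsgen L (Alpha i) *m (W0 ^+ b *m U^T) = W0 ^+ b *m U^T.
  rewrite (divn_eq b k) addnC mulnC exprD exprM W0k scalar_mxX -mulmxE mul_mx_scalar.
  by rewrite -!scalemxAl -!scalemxAr fixUk // ltn_pmod.
have fixUW0 : (U *m W0^T <= U)%MS.
  apply/sub_bigcapmxP => j _; apply/sub_bigcapmxP => i _; apply/fixP.
  rewrite monodromy_line_gen trmx_mul trmxK -!mulmxA VK; last by have := ltn_ord j; lia.
  rewrite (_ : W0 *m U^T = W0 ^+ 1 *m U^T) // -W0D -!scalemxAr fixU W0D.
  by rewrite scalemxAr -VK ?mulKVmx //; have := ltn_ord j; lia.
apply: (stable_agree_eq0 (W := (lsgen L Omegaoo)^T)) fixUW0 _ _ (scalarX_unit_tr Wk);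
  last first.
  by rewrite -trmxX W0k tr_scalar_mx.
apply: trmx_inj; rewrite !trmx_mul !trmxK.
have AU : \prod_(i < ell) lsgen L (Alpha i) \in unitmx.
  by rewrite -(weval_prod (lsgen L) _ (fun i => WGen (Alpha i))) weval_unit //;
    apply: lsgen_unit.
apply: (can_inj (mulKmx AU)); rewrite mulmxA rel_prod -[W0]expr1 prod_fix // => i;
  exact: fixU.
Qed.

End PochhammerCondition.

(** * Local systems from matrices; companion matrices *)

Section Construction.

Variable K : fieldType.

Lemma conj_scalarsX (d nu : nat) (M : 'M[K]_d) (xi : 'I_nu -> K)
    (m : 'I_nu -> nat) (k : nat) (c : K) :
  conj_scalars M xi m -> (forall j, xi j ^+ k = c) -> M ^+ k = c%:M.
Proof.
move=> /conj_scalarsE[P [Q [_ MP _ _ sumPQ]]] xik.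
have MkP i j : M ^+ i *m P j = xi j ^+ i *: P j.
  elim: i => [|i IH]; first by rewrite !expr0 mul1mx scale1r.
  by rewrite exprSr -mulmxE -mulmxA MP -scalemxAr IH scalerA exprS.
rewrite -[LHS]mulmx1 -[in RHS](mulmx1 c%:M) -sumPQ !mulmx_sumr; apply: eq_bigr => j _.
by rewrite !mulmxA MkP xik mul_scalar_mx.
Qed.

Lemma conj_scalars_unit (d nu : nat) (M : 'M[K]_d) (xi : 'I_nu -> K)
    (m : 'I_nu -> nat) :
  conj_scalars M xi m -> (forall j, xi j != 0) -> M \in unitmx.
Proof.
move=> Mxi xi0; rewrite -[M]expr1 -[M ^+ 1]subr0 -(raddf0 (@scalar_mx K d)).
by apply: conj_scalarsX_unit Mxi _ => j; rewrite expr1.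
Qed.

Section Builder.

Variables (n k ell : nat) (r s : int) (d : nat).
Variables (A : 'I_ell -> 'M[K]_d) (W0 Woo : 'M[K]_d) (eps : K).
Hypotheses (AU : forall i, A i \in unitmx) (W0U : W0 \in unitmx) (WooU : Woo \in unitmx).
Hypotheses (eps0 : eps != 0) (AE : (\prod_i A i) *m Woo = W0).
Hypotheses (W0k : W0 ^+ k = (eps ^ r)%:M) (Woon : Woo ^+ n = (eps ^ s)%:M).

Definition complement_gen (x : cgen ell) : 'M[K]_d :=
  match x with
  | Alpha i => A i
  | Omega0 => W0
  | Omegaoo => Woo
  | Delta => eps%:M
  end.

Lemma complement_gen_unit x : complement_gen x \in unitmx.
Proof. by case: x => // /=; rewrite unitmxE det_scalar unitfE expf_neq0. Qed.

Lemma complement_gen_rel u v : Defs.rel (p := pi1_complement n k ell r s) u v ->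
  weval complement_gen u = weval complement_gen v.
Proof.
case=> [_ _ [_ _ [|x]|]|].
- by rewrite /= weval_prod.
- by rewrite /= scalar_mxC.
- by rewrite weval_wpow_nat (@weval_wpow_scalar _ _ _ _ _ eps).
- by rewrite weval_wpow_nat (@weval_wpow_scalar _ _ _ _ _ eps).
Qed.

Definition complement_locsys : locsys K (pi1_complement n k ell r s) :=
  @LocSys K (pi1_complement n k ell r s) d complement_gen
    complement_gen_unit complement_gen_rel.

End Builder.

Section Companion.

Variables (k : nat) (z : 'I_k -> K).
Hypothesis z_inj : injective z.

Let V : 'M[K]_k := Vandermonde k (\row_j z j).

(* The companion matrix of [\prod_j ('X - z j)], diagonalised by a Vandermonde
   matrix: only its last row depends on [z]. *)
Definition companion_of_roots : 'M[K]_k := V *m diag_mx (\row_j z j) *m invmx V.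

Lemma vandermonde_unit : V \in unitmx.
Proof.
rewrite unitmxE det_Vandermonde unitfE; apply/prodf_neq0 => i _; apply/prodf_neq0 => j ij.
by rewrite !mxE subr_eq0; apply: contraTneq ij => /z_inj ->; rewrite ltnn.
Qed.

(** Scaling the columns of the Vandermonde matrix by the [z j] turns the row of [i]-th powers into
    the next row. *)
Lemma companion_of_roots_row (i i' : 'I_k) :
  i' = i.+1 :> nat -> row i companion_of_roots = delta_mx 0 i'.
Proof.
move=> ii'; have -> : delta_mx 0 i' = row i' V *m invmx V.
  by rewrite -row_mul mulmxV ?vandermonde_unit // row1.
rewrite row_mul; congr (_ *m _); apply/rowP => j;
  rewrite !mxE (bigD1 j) //= big1 => [|l lj].
  by rewrite !mxE eqxx mulr1n addr0 ii' exprSr.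
by rewrite !mxE (negPf lj) mulr0n mulr0.
Qed.

Lemma det_companion_of_roots : \det companion_of_roots = \prod_j z j.
Proof.
rewrite !det_mulmx det_inv mulrAC divff ?mul1r; last first.
  by rewrite -unitfE -unitmxE vandermonde_unit.
by rewrite det_diag; apply: eq_bigr => j _; rewrite mxE.
Qed.

Lemma companion_of_roots_conj_scalars : conj_scalars companion_of_roots z (fun=> 1%N).
Proof.
apply: eigen_conj_scalars => // [j|]; last by rewrite sum1_card card_ord.
rewrite lt0n mxrank_eq0; apply/rowV0Pn; exists (row j (invmx V)).
  apply/eigenspaceP; rewrite -row_mul !mulmxA mulVmx ?vandermonde_unit // mul1mx.
  by rewrite row_mul row_diag_mx mxE -scalemxAl -rowE.
apply/eqP => /(congr1 (mulmx^~ V)); rewrite -row_mul mulVmx ?vandermonde_unit // mul0mx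
  row1.
by move=> /rowP/(_ j)/eqP; rewrite !mxE !eqxx oner_eq0.
Qed.

End Companion.

Lemma companion_of_roots_diff (k : nat) (z t : 'I_k -> K) :
  injective z -> injective t -> (0 < k)%N ->
  exists (e : 'M[K]_(k, 1)) (w : 'M[K]_(1, k)),
    companion_of_roots z = companion_of_roots t + e *m w.
Proof.
move=> zinj tinj k0; have lk : (k.-1 < k)%N by rewrite prednK.
move: (companion_of_roots z) (companion_of_roots t) (@companion_of_roots_row k z zinj)
  (@companion_of_roots_row k t tinj) => Cz Ct rowz rowt.
exists (delta_mx (Ordinal lk) 0), (row (Ordinal lk) (Cz - Ct)).
apply/row_matrixP => i; rewrite linearD /= row_mul; have [ik|ik] := ltnP i.+1 k.
  rewrite !(rowz _ (Ordinal ik), rowt _ (Ordinal ik)) //.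
  rewrite (_ : row i (delta_mx (Ordinal lk) (0 : 'I_1)) = 0) ?mul0mx ?addr0 //;
    apply/rowP => j; rewrite !mxE (ord1 j) eqxx andbT.
  by case: eqP => // il; move: ik; rewrite il /= prednK // ltnn.
have -> : i = Ordinal lk by apply: val_inj => /=; have := ltn_ord i; lia.
rewrite (_ : row _ (delta_mx _ (0 : 'I_1)) = 1%:M) ?mul1mx; last by apply/rowP => j;
  rewrite !mxE eqxx !ord1.
by rewrite linearB /= addrC subrK.
Qed.

End Construction.

(** * Criterion for rigid Pochhammer local systems; the case of one component *)

Section RigidPochhammer.

Variable K : fieldType.

Definition rigid_pochhammer (n k ell : nat) (r s : int)
    (L : locsys K (pi1_complement n k ell r s)) (eps : K) (lambda : 'I_ell -> K)
    (nu : nat) (xi : 'I_nu -> K) (m : 'I_nu -> nat) : Prop :=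
  [/\ local_data L eps lambda xi m, ls_irreducible L, ls_rigid L, pochhammer L &
      multiplicity_one L].

(** The common last step for all three local systems: as [Q *m P = 1], the [alpha_i] inherit rank
    and determinant from the small matrices [B i], and the criteria above apply. *)
Lemma rigid_pochhammer_of_factorization (n k ell : nat) (r s : int)
    (L : locsys K (pi1_complement n k ell r s))
    (P : 'M[K]_(lsdim L, ell)) (Q : 'M[K]_(ell, lsdim L)) (B : 'I_ell -> 'M[K]_ell)
    (eps : K) (lambda : 'I_ell -> K) (zeta : 'I_k -> K)
    (nu : nat) (xi : 'I_nu -> K) (m : 'I_nu -> nat) :
  (0 < k)%N -> (0 < ell)%N -> eps != 0 ->
  injective zeta -> (forall j, zeta j ^+ k = eps ^ r) ->
  injective xi -> (forall j, xi j ^+ k != eps ^ r) ->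
  (forall i, \rank (B i - 1%:M)%R = 1%N) -> (forall i, \det (B i) = lambda i) ->
  (forall i, lambda i != 1) ->
  (forall U : 'M_ell, (forall i, U *m (B i)^T <= U)%MS -> U = 0 \/ row_full U) ->
  Q *m P = 1%:M ->
  (forall i, lsgen L (Alpha i) = 1%:M + P *m (B i - 1%:M) *m Q) ->
  lsgen L Delta = eps%:M ->
  conj_scalars (lsgen L Omega0) zeta (fun=> ell) ->
  conj_scalars (lsgen L Omegaoo) xi m ->
  (k * (ell * ell) < \sum_j m j * m j + 2 * ell)%N ->
  rigid_pochhammer L eps lambda xi m.
Proof.
move=> k0 ell0 eps0 zinj zk xinj xk rkB detB lam1 irrB QP AE Ldelta L0 Loo ineq.
have cA i : codimfix (lsgen L (Alpha i)) = 1%N.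
  rewrite codimfixE AE addrC addKr mxrankMfree; last by apply/row_freeP; exists P.
  rewrite -mxrank_tr trmx_mul mxrankMfree ?mxrank_tr ?rkB //.
  by apply/row_freeP; exists Q^T; rewrite -trmx_mul QP trmx1.
have detA i : \det (lsgen L (Alpha i)) = lambda i.
  by rewrite AE -mulmxA det_1D_mulC -mulmxA QP mulmx1 addrC subrK detB.
have data : local_data L eps lambda xi m.
  split=> // [i|]; last by exists zeta.
  split; last exact: detA.
  by split; [exact: lsgen_unit | exact: cA | rewrite detA].
have Wk := conj_scalarsX_unit Loo xk.
have irrL := irreducible_of_factorization ell0 QP AE irrB Ldelta Wk.
have dimL : lsdim L = (k * ell)%N by rewrite -(conj_scalars_dim L0) sum_nat_const card_ord.
have [poch mult] := pochhammer_of_codimfix eps0 Ldelta k0 dimL cA Wk.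
by split=> //; apply: rigid_of_local_data k0 data irrL ineq.
Qed.

(* The monodromy around [Y_bullet] is [D] on the column space of [P] and trivial
   on the complement [Q = 0]. *)
Definition has_factorization (n k : nat) (r s : int)
    (L : locsys K (pi1_complement n k 1 r s)) (w : nat) (D : 'M[K]_w) :=
  exists (P : 'M[K]_(lsdim L, w)) (Q : 'M[K]_(w, lsdim L)),
    Q *m P = 1%:M /\
    forall i, lsgen L (Alpha i) = 1%:M + P *m (D - 1%:M) *m Q.

(* Levelt's construction of irreducible hypergeometric representations. *)
Lemma exists_rigid_pochhammer_1 (n k : nat) (r s : int) (eps eta : K)
    (zeta xi : 'I_k -> K) :
  (0 < k)%N -> eps != 0 ->
  injective zeta -> (forall j, zeta j ^+ k = eps ^ r) ->
  injective xi -> (forall j, xi j ^+ k != eps ^ r) ->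
  (forall j, xi j != 0) -> (forall j, xi j ^+ n = eps ^ s) ->
  eta = \prod_j zeta j / \prod_j xi j -> eta != 1 ->
  exists F : locsys K (pi1_complement n k 1 r s),
  [/\ rigid_pochhammer F eps (fun=> eta) xi (fun=> 1%N),
      conj_scalars (lsgen F Omega0) zeta (fun=> 1%N) &
      has_factorization F (eta%:M : 'M_1)].
Proof.
move=> k0 eps0 zinj zk xinj xk xi0 xn etaE eta1.
have zeta0 j : zeta j != 0.
  by have := expfz_neq0 r eps0; rewrite -(zk j) expf_eq0 k0.
have L0 := companion_of_roots_conj_scalars zinj.
have Loo := companion_of_roots_conj_scalars xinj.
have U0 := conj_scalars_unit L0 zeta0; have Uoo := conj_scalars_unit Loo xi0.
have [e [w E]] := companion_of_roots_diff zinj xinj k0.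
set W0 := companion_of_roots zeta in L0 U0 E; set W := companion_of_roots xi in Loo Uoo E.
pose q := w *m invmx W.
have AE : W0 *m invmx W = 1%:M + e *m q by rewrite E mulmxDl mulmxV // mulmxA.
(* Sylvester's identity: [1 + q *m e] is the quotient of the determinants of [W0] and [W], that is
   [eta]. As [eta != 1], rescaling [q] yields the left inverse of [e] used below. *)
have qe : q *m e = (eta - 1)%:M.
  have : \det (W0 *m invmx W) = eta.
    by rewrite det_mulmx det_inv !det_companion_of_roots // etaE.
  rewrite AE det_1D_mulC det_mx11 mxE [1%:M 0 0]mxE eqxx mulr1n => <-.
  by rewrite addrAC subrr add0r -mx11_scalar.
have AU : W0 *m invmx W \in unitmx by rewrite unitmx_mul U0 unitmx_inv.
have relp : (\prod_(i < 1) (W0 *m invmx W)) *m W = W0 by rewrite big_ord1 mulmxKV.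
pose F := complement_locsys (n := n) (r := r) (s := s) (fun _ : 'I_1 => AU) U0 Uoo eps0 relp
  (conj_scalarsX L0 zk) (conj_scalarsX Loo xn).
have eta10 : eta - 1 != 0 by rewrite subr_eq0.
have QP : ((eta - 1)^-1 *: q) *m e = 1%:M.
  by rewrite -scalemxAl qe scale_scalar_mx mulVf.
have FA (i : 'I_1) : lsgen F (Alpha i) = 1%:M + e *m (eta%:M - 1%:M) *m ((eta - 1)^-1 *: q).
  rewrite /= AE -raddfB /= mul_mx_scalar -scalemxAl -scalemxAr scalerA divff ?scale1r //.
exists F; split=> //; last by exists e, ((eta - 1)^-1 *: q).
apply: (rigid_pochhammer_of_factorization (B := fun=> eta%:M) (zeta := zeta)) (FA) _ _ _ _
  => //.
- by move=> _; rewrite -raddfB /= mxrank_unit // unitmxE det_scalar unitfE expf_neq0.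
- by move=> _; rewrite det_scalar expr1.
- move=> U _; have [->|Unz] := eqVneq U 0; [by left | right].
  by rewrite /row_full eqn_leq rank_leq_col lt0n mxrank_eq0.
- by rewrite sum1_card card_ord; lia.
Qed.

End RigidPochhammer.

(** * Jordan-Pochhammer matrices *)

Section JordanPochhammer.

Variables (K : fieldType) (ell : nat) (lambda : 'I_ell -> K) (eta : K).

Let q : 'rV[K]_ell := \row_j (lambda j - eta).

(** In the product of the factors after [i], row [j > i] is [eta *: e_j] modulo [q]. The division by
    [eta] compensates for this, so that the next factor on the left makes row [i] equal to
    [eta *: e_i] modulo [q]. The diagonal entry fixes the determinant. *)
Definition jp_row (i : 'I_ell) : 'rV[K]_ell :=
  \row_j (if (j < i)%N then lambda j - eta
          else if j == i then lambda i - 1 else (lambda j - eta) / eta).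

Definition jp_mx (i : 'I_ell) : 'M[K]_ell := 1%:M + delta_mx i 0 *m jp_row i.

Lemma row_jp_mx_mul p i j (X : 'M_(ell, p)) :
  row j (jp_mx i *m X) = row j X + (j == i)%:R *: (jp_row i *m X).
Proof.
rewrite mulmxDl mul1mx linearD /= -mulmxA row_mul; congr (_ + _).
rewrite (_ : row j _ = (j == i)%:R%:M) ?mul_scalar_mx //.
by apply/rowP => a; rewrite !mxE (ord1 a) eqxx andbT.
Qed.

(* Multiplying by [jp_mx i] only changes the [i]-th row, so that the rows of
   the product can be computed from the last one upwards. *)
Lemma prod_jp_mx_row (e : seq 'I_ell) :
  eta != 0 -> sorted ltn (map val e) ->
  (forall i j : 'I_ell, i \in e -> (i < j)%N -> j \in e) ->
  exists u : 'I_ell -> K, forall i,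
    row i (\prod_(l <- e) jp_mx l) =
      if i \in e then eta *: delta_mx 0 i + u i *: q else delta_mx 0 i.
Proof.
move=> eta0; elim: e => [|l e IH] srt cl.
  by exists (fun=> 0) => i; rewrite big_nil row1.
have le i : i \in e -> (l < i)%N.
  move=> ie; have := order_path_min ltn_trans srt; move/allP; apply.
  exact: map_f.
have [|i j ie ij|u uE] := IH; first exact: path_sorted srt.
  have := cl i j; rewrite !inE ie orbT => /(_ isT ij) /predU1P[jl|//].
  by have := le _ ie; rewrite -jl ltnNge ltnW.
have lNe : l \notin e by apply: contraT; rewrite negbK => /le; rewrite ltnn.
have memE j : (j \in e) = (l < j)%N.
  apply/idP/idP => [/le //|lj]; have := cl l j (mem_head _ _) lj.
  by rewrite inE => /predU1P[jl|//]; move: lj; rewrite jl ltnn.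
pose P := \prod_(l <- e) jp_mx l.
(* In the coefficient of [q] in row [l], the [1] collects the entries [lambda j - eta], the sum
   comes from the terms [u j *: q] of the later rows. *)
exists (fun i => if i == l then 1 + \sum_(j : 'I_ell | (l < j)%N) (lambda j - eta) / eta *
  u j else u i) => i.
rewrite big_cons -mulmxE row_jp_mx_mul inE; case: eqVneq => [->|il]; last first.
  by rewrite scale0r addr0 uE.
rewrite scale1r uE (negPf lNe) /=.
have PE j a : P j a = (if (l < j)%N then eta else 1) * (a == j)%:R +
    (if (l < j)%N then u j * q 0 a else 0).
  have -> : P j a = row j P 0 a by rewrite [RHS]mxE.
  rewrite uE memE; case: ifP => _; rewrite ?addr0 ?mul1r //; last by rewrite mxE.
  by rewrite !mxE.
apply/rowP => a; rewrite [LHS]mxE [RHS]mxE; rewrite -/P [(_ *m P) 0 a]mxE.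
rewrite (eq_bigr _ (fun j _ => etrans (congr1 _ (PE j a)) (mulrDr _ _ _))).
rewrite big_split /= (bigD1 a) //= [\sum_(i < _ | i != a) _]big1 => [|j ja]; last first.
  by rewrite [a == j]eq_sym (negPf ja) !mulr0.
have -> : \sum_j jp_row l 0 j * (if (l < j)%N then u j * q 0 a else 0) =
    (\sum_(j : 'I_ell | (l < j)%N) (lambda j - eta) / eta * u j) * q 0 a.
  rewrite mulr_suml [RHS]big_mkcond; apply: eq_bigr => j _.
  case: (ltnP l j) => lj; last by rewrite mulr0.
  by rewrite mxE ltnNge ltnW //= -val_eqE /= gtn_eqF // mulrA.
set S := \sum_(j | _) _; rewrite !mxE !eqxx /= addr0.
case: (ltngtP a l) => [al|la|/val_inj ->].
- rewrite -val_eqE /= ltn_eqF //= mulr0n; ring.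
- by rewrite -val_eqE /= gtn_eqF //= mulr0n; field.
- by rewrite eqxx mulr1n; ring.
Qed.

Lemma prod_jp_mx : eta != 0 ->
  exists u : 'cV[K]_ell, \prod_i jp_mx i = eta%:M + u *m q.
Proof.
move=> eta0; have [||u uE] := @prod_jp_mx_row (enum 'I_ell) eta0.
- by rewrite val_enum_ord iota_ltn_sorted.
- by move=> i j _ _; rewrite mem_enum.
exists (\col_i u i); apply/row_matrixP => i.
have -> : \prod_l jp_mx l = \prod_(l <- enum 'I_ell) jp_mx l by rewrite enumT [index_enum
  _]unlock.
rewrite uE mem_enum /=.
rewrite linearD /= row_mul -scalemx1 linearZ /= row1; congr (_ + _).
by rewrite -mul_scalar_mx; congr (_ *m _); apply/rowP => a; rewrite !mxE (ord1 a).
Qed.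

Lemma det_jp_mx i : \det (jp_mx i) = lambda i.
Proof.
rewrite det_1D_mulC -colE det_mx11 !mxE !eqxx ltnn mulr1n; ring.
Qed.

Lemma rank_jp_mx i : lambda i != 1 -> \rank (jp_mx i - 1%:M) = 1%N.
Proof.
move=> li; rewrite addrC addKr; apply/eqP; rewrite eqn_leq.
rewrite (leq_trans (mxrankM_maxr _ _) (rank_leq_row _)) lt0n mxrank_eq0.
apply/eqP => /matrixP/(_ i i)/eqP; rewrite mxE big_ord1 !mxE !eqxx ltnn mul1r.
by rewrite subr_eq0 (negPf li).
Qed.

(** If every [jp_row i] vanishes on [U], the product fixes [U], which is then zero. Otherwise some
    basis vector [e_i] lies in [U], and since the entries [jp_row j 0 i] are nonzero, every [e_j]
    does. *)
Lemma jp_mx_irreducible (U : 'M[K]_ell) :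
  (forall i, lambda i != 1) -> (forall i, lambda i != eta) -> eta != 0 ->
  \prod_i jp_mx i - 1%:M \in unitmx ->
  (forall i, U *m (jp_mx i)^T <= U)%MS -> U = 0 \/ row_full U.
Proof.
move=> lam1 lam_eta eta0 B1 stU.
have rowN0 i j : jp_row i 0 j != 0.
  rewrite mxE; case: ifP => _; first by rewrite subr_eq0.
  by case: (j == i); rewrite ?mulf_eq0 ?negb_or ?invr_eq0 subr_eq0 ?lam_eta.
have stU1 i : (U *m (jp_row i)^T *m delta_mx 0 i <= U)%MS.
  have -> : U *m (jp_row i)^T *m delta_mx 0 i = U *m (jp_mx i)^T - U.
    rewrite /jp_mx linearD /= trmx1 trmx_mul trmx_delta mulmxDr mulmx1 addrAC subrr add0r.
    by rewrite mulmxA.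
  by rewrite addmx_sub ?eqmx_opp.
have [/forallP Uz|/forallPn[i Ui]] := boolP [forall i, U *m (jp_row i)^T == 0].
  left; have fixU : (\prod_i jp_mx i) *m U^T = U^T.
    apply: prod_fix => i; rewrite mulmxDl mul1mx -mulmxA.
    rewrite (_ : jp_row i *m U^T = 0) ?mulmx0 ?addr0 //.
    by apply: trmx_inj; rewrite trmx_mul trmxK trmx0; apply/eqP/Uz.
  apply: trmx_inj; rewrite trmx0 -[U^T](mulKmx B1) mulmxBl mul1mx fixU subrr mulmx0 //.
right; have ei : (delta_mx (0 : 'I_1) i <= U)%MS.
  have /matrix0Pn[a [b ab]] := Ui.
  have := row_sub a (U *m (jp_row i)^T *m delta_mx 0 i).
  rewrite row_mul => /submx_trans /(_ (stU1 i)).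
  rewrite (_ : row a _ = ((U *m (jp_row i)^T) a b)%:M); last first.
    by apply/rowP => c; rewrite !mxE (ord1 c) (ord1 b) mulr1n.
  by rewrite mul_scalar_mx eqmx_scale.
rewrite -sub1mx; apply/row_subP => j; rewrite row1.
have : (delta_mx (0 : 'I_1) i *m (jp_row j)^T *m delta_mx (0 : 'I_1) j <= U)%MS.
  by rewrite -mulmxA (submx_trans (submxMr _ ei)) // mulmxA.
rewrite (_ : delta_mx 0 i *m _ = (jp_row j 0 i)%:M) ?mul_scalar_mx ?eqmx_scale //.
by apply/rowP => c; rewrite -rowE !mxE (ord1 c) mulr1n.
Qed.

End JordanPochhammer.

(** * Direct sums and their factorisations *)

Section DirectSums.

Variable K : fieldType.

Definition pair_fun (T : Type) (a b : T) (j : 'I_2) : T := if j == 0 then a else b.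

Lemma pair_fun_inj (T : eqType) (a b : T) : a != b -> injective (pair_fun a b).
Proof.
by move=> ab; case=> [[|[|i]] // hi] [[|[|j]] // hj] /eqP;
  rewrite /pair_fun -!val_eqE /= ?(negPf ab) 1?eq_sym ?(negPf ab) // => _; apply: val_inj.
Qed.

Lemma conj_scalars_pair d (M : 'M[K]_d) (a b : K) (m : nat) :
  a != b -> d = m.+1 -> (m <= \rank (eigenspace M a))%N ->
  (0 < \rank (eigenspace M b))%N ->
  conj_scalars M (pair_fun a b) (pair_fun m 1%N).
Proof.
move=> ab dm ra rb; apply: eigen_conj_scalars; first exact: pair_fun_inj.
  by case=> [[|[|j]] // hj]; rewrite /pair_fun -val_eqE.
by rewrite big_ord_recl big_ord1 /pair_fun /= dm addn1.
Qed.

(** The eigenspace of [a] has codimension at most one, and [q] is an eigenvector with eigenvalue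
    [a + q *m u]. By Sylvester's identity the determinant is [a ^+ m * (a + q *m u)], so this
    eigenvalue is [b]. *)
Lemma rank_one_update_conj_scalars m (u : 'cV[K]_m.+1) (q : 'rV[K]_m.+1) (a b : K) :
  a != 0 -> a != b -> q != 0 -> \det (a%:M + u *m q) = a ^+ m * b ->
  conj_scalars (a%:M + u *m q) (pair_fun a b) (pair_fun m 1%N).
Proof.
move=> a0 ab q0 detB; apply: conj_scalars_pair => //.
  rewrite /eigenspace addrAC subrr add0r mxrank_ker.
  suff : (\rank (u *m q) <= 1)%N by lia.
  exact: leq_trans (mxrankM_maxl _ _) (rank_leq_col _).
rewrite lt0n mxrank_eq0; apply/rowV0Pn; exists q => //; apply/eigenspaceP.
rewrite mulmxDr mul_mx_scalar mulmxA [q *m u]mx11_scalar mul_scalar_mx -scalerDl.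
congr (_ *: _); apply: (mulfI (expf_neq0 m a0)); rewrite -detB.
have -> : a%:M + u *m q = a *: (1%:M + u *m (a^-1 *: q)).
  by rewrite scalerDr scale_scalar_mx mulr1 -scalemxAr scalerA divff // scale1r.
set t := (q *m u) 0 0.
rewrite detZ det_1D_mulC det_mx11 -scalemxAl [LHS]mulrC.
rewrite (_ : (1%:M + a^-1 *: (q *m u)) 0 0 = 1 + a^-1 * t); last first.
  by rewrite mxE [1%:M 0 0]mxE [X in _ + X]mxE eqxx mulr1n.
by rewrite exprSr; field.
Qed.

Lemma rank_eigenspace_block d d' (A : 'M[K]_d) (A' : 'M[K]_d') a :
  \rank (eigenspace (block_mx A 0 0 A') a) =
  (\rank (eigenspace A a) + \rank (eigenspace A' a))%N.
Proof.
rewrite /eigenspace !mxrank_ker scalar_mx_block opp_block_mx add_block_mx !oppr0 !addr0.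
rewrite rank_diag_block_mx.
have := rank_leq_row (A - a%:M); have := rank_leq_row (A' - a%:M); lia.
Qed.

Variables (n k : nat) (r s : int).
Variables (F G : locsys K (pi1_complement n k 1 r s)).

Lemma rank_eigenspace_lsmuln m x a :
  \rank (eigenspace (lsgen (lsmuln F m) x) a) = (m * \rank (eigenspace (lsgen F x) a))%N.
Proof.
elim: m => [|m IH]; first by apply/eqP; rewrite -leqn0 rank_leq_row.
by rewrite rank_eigenspace_block IH mulSn.
Qed.

Lemma lsdim_lsmuln m : lsdim (lsmuln F m) = (m * lsdim F)%N.
Proof. by elim: m => //= m ->; rewrite mulSn. Qed.

Lemma has_factorization_lsadd (L M : locsys K (pi1_complement n k 1 r s)) w v (D : 'M_w)
  (E : 'M_v) :
  has_factorization L D -> has_factorization M E ->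
  has_factorization (lsadd L M) (block_mx D 0 0 E).
Proof.
move=> [P [Q [QP LA]]] [P' [Q' [QP' MA]]].
exists (block_mx P 0 0 P'), (block_mx Q 0 0 Q'); split=> [|i].
  by rewrite mulmx_block !(mulmx0, mul0mx, addr0, add0r) QP QP' -scalar_mx_block.
rewrite /= /lsadd_gen LA MA !scalar_mx_block opp_block_mx add_block_mx !oppr0 !addr0.
by rewrite !mulmx_block !(mulmx0, mul0mx, addr0, add0r) add_block_mx !addr0.
Qed.

Lemma has_factorization_lsmuln m (a : K) :
  has_factorization F (a%:M : 'M_1) -> has_factorization (lsmuln F m) (a%:M : 'M_m).
Proof.
move=> hF; elim: m => [|m IH].
  exists 0, 0; split=> [|i]; first by apply/matrixP; case.
  by apply/matrixP; case.
rewrite -[m.+1]/(1 + m)%N (scalar_mx_block 1 m); exact: has_factorization_lsadd.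
Qed.

Lemma lsmuln_scalar m (c : K) : lsgen F Delta = c%:M -> lsgen (lsmuln F m) Delta = c%:M.
Proof.
move=> Fc; elim: m => [|m IH]; first by apply/matrixP; case.
by rewrite /= /lsadd_gen Fc IH -scalar_mx_block.
Qed.

Lemma has_factorization_similar (L : locsys K (pi1_complement n k 1 r s)) w v
    (D : 'M_w) (E : 'M_v) (S : 'M_(v, w)) (T : 'M_(w, v)) :
  S *m T = 1%:M -> T *m S = 1%:M -> S *m D = E *m S ->
  has_factorization L D -> has_factorization L E.
Proof.
move=> ST TS SD [P [Q [QP LA]]]; exists (P *m T), (S *m Q); split=> [|i].
  by rewrite -mulmxA (mulmxA Q) QP mul1mx.
rewrite LA; congr (_ + _).
have -> : D - 1%:M = T *m (E - 1%:M) *m S.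
  by rewrite mulmxBr mulmx1 mulmxBl TS -mulmxA -SD mulmxA TS mul1mx.
by rewrite !mulmxA.
Qed.

End DirectSums.

(** * Roots of a scalar, and products of factorised matrices *)

Section Roots.

Variable K : fieldType.

Lemma prod_roots (k : nat) (zeta : 'I_k -> K) (c : K) :
  (0 < k)%N -> injective zeta -> (forall j, zeta j ^+ k = c) ->
  \prod_j zeta j = (-1) ^+ k.-1 * c.
Proof.
move=> k0 zinj zk; have := congr1 (horner^~ 0) (prod_XsubC_roots k0 zinj zk).
rewrite horner_prod !hornerE (eq_bigr (fun j => - zeta j)) => [|j _];
  last by rewrite !hornerE.
rewrite prodrN card_ord expr0n eqn0Ngt k0 /= add0r -{1}(prednK k0) exprS mulN1r => E.
by rewrite -[LHS](signrMK k.-1); congr (_ * _); apply: oppr_inj; rewrite -E mulNr.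
Qed.

(** As [Q *m P = 1], the map [B |-> 1 + P (B - 1) Q] extends [B] by the identity on the kernel of
    [Q], and is multiplicative. *)
Lemma prod_factorization d m (I : Type) (e : seq I) (P : 'M[K]_(d, m)) (Q : 'M[K]_(m, d))
    (B : I -> 'M[K]_m) : Q *m P = 1%:M ->
  \prod_(i <- e) (1%:M + P *m (B i - 1%:M) *m Q) =
  1%:M + P *m (\prod_(i <- e) B i - 1%:M) *m Q.
Proof.
move=> QP; elim: e => [|i e IH].
  by rewrite !big_nil subrr mulmx0 mul0mx addr0.
rewrite !big_cons IH -!mulmxE mulmxDl mul1mx mulmxDr mulmx1 -addrA; congr (_ + _).
set C := \prod_(l <- e) B l.
have -> : P *m (B i - 1%:M) *m Q *m (P *m (C - 1%:M) *m Q) =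
          P *m ((B i - 1%:M) *m (C - 1%:M)) *m Q.
  by rewrite -!mulmxA (mulmxA Q) QP mul1mx.
rewrite -!mulmxDl -!mulmxDr; congr (_ *m _ *m _).
rewrite mulmxBl mul1mx mulmxBr mulmx1.
by rewrite addrCA [X in _ + X]addrC subrK addrC addrA subrK.
Qed.

End Roots.

Lemma exists_roots (C : numClosedFieldType) (k : nat) (c : C) :
  (0 < k)%N -> c != 0 ->
  exists2 zeta : 'I_k -> C, injective zeta & forall j, zeta j ^+ k = c.
Proof.
move=> k0 c0; have [rs rsE] := closed_field_poly_normal ('X^k - 1 : {poly C}).
have sep : uniq rs.
  have : separable.separable_poly ('X^k - 1 : {poly C}).
    by rewrite cyclotomic.separable_Xn_sub_1 // pnatr_eq0 -lt0n.
  by rewrite rsE (monicP (monicXnsubC 1 k0)) scale1r separable.separable_prod_XsubC.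
have sz : size rs = k.
  have := size_XnsubC (1 : C) k0.
  by rewrite polyC1 rsE (monicP (monicXnsubC 1 k0)) scale1r size_prod_XsubC => -[].
have y0 : k.-root c != 0 by rewrite rootC_eq0.
exists (fun j => k.-root c * rs`_j) => [i j|j].
  move=> /(mulfI y0)/eqP; rewrite nth_uniq ?sz // => /eqP; exact: val_inj.
rewrite exprMn rootCK //; have : root ('X^k - 1) rs`_j.
  rewrite rsE (monicP (monicXnsubC 1 k0)) scale1r root_prod_XsubC mem_nth ?sz //.
by rewrite rootE !hornerE subr_eq0 => /eqP->; rewrite mulr1.
Qed.

(** * Construction of the local system, and the theorem *)

Section Main.

Variable K : fieldType.

(* The restriction to the complement of the fat curve is built first, as
   [F^m + G]; factoring the middle matrix of its monodromy along [Y_bullet] into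
   Jordan-Pochhammer pseudo-reflections then gives the local system itself. *)
Lemma exists_rigid_pochhammer (n k m : nat) (r s : int) (eps eta1 eta2 : K)
    (lambda : 'I_m.+1 -> K) (zeta : 'I_k.+1 -> K) (xi : 'I_k.+2 -> K)
    (xiF xiG : 'I_k.+1 -> K) (F G : locsys K (pi1_complement n k.+1 1 r s)) :
  eps != 0 -> eta1 != 0 ->
  injective zeta -> (forall j, zeta j ^+ k.+1 = eps ^ r) ->
  injective xi -> (forall j, xi j ^+ k.+1 != eps ^ r) ->
  (forall j, xi j ^+ n = eps ^ s) ->
  (forall i, lambda i != 0) -> (forall i, lambda i != 1) -> (forall i, lambda i != eta1) ->
  eta1 != 1 -> eta2 != 1 -> eta1 != eta2 ->
  \prod_i lambda i = eta1 ^+ m * eta2 ->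
  (forall j : 'I_k.+1, xiF j = xi (inord j)) ->
  (forall j : 'I_k.+1, xiG j = if (j < k)%N then xi (inord j) else xi ord_max) ->
  conj_scalars (lsgen F Omega0) zeta (fun=> 1%N) ->
  conj_scalars (lsgen G Omega0) zeta (fun=> 1%N) ->
  conj_scalars (lsgen F Omegaoo) xiF (fun=> 1%N) ->
  conj_scalars (lsgen G Omegaoo) xiG (fun=> 1%N) ->
  lsgen F Delta = eps%:M -> lsgen G Delta = eps%:M ->
  has_factorization F (eta1%:M : 'M_1) -> has_factorization G (eta2%:M : 'M_1) ->
  exists L : locsys K (pi1_complement n k.+1 m.+1 r s),
    rigid_pochhammer L eps lambda xi
      (fun j : 'I_k.+2 => if (j < k)%N then m.+1 else if (j == k :> nat) then m else 1%N) /\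
    isols (ls_restrict (fat_hom n k.+1 m.+1 r s) L) (lsadd (lsmuln F m) G).
Proof.
move=> eps0 eta10 zinj zk xinj xk xn lam0 lam1 lamE eta11 eta21 eta12 prodE xiFE xiGE.
move=> F0 G0 Foo Goo Fd Gd Ff Gf.
set N := lsadd (lsmuln F m) G.
have dimN : lsdim N = (m * k.+1 + k.+1)%N.
  rewrite /= lsdim_lsmuln -(conj_scalars_dim F0) -(conj_scalars_dim G0).
  by rewrite sum1_card card_ord.
have Nd : lsgen N Delta = eps%:M.
  by rewrite /= /lsadd_gen Gd (lsmuln_scalar _ Fd) -scalar_mx_block.
have rkN x a : \rank (eigenspace (lsgen N x) a) =
    (m * \rank (eigenspace (lsgen F x) a) + \rank (eigenspace (lsgen G x) a))%N.
  by rewrite rank_eigenspace_block rank_eigenspace_lsmuln.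
have N0 : conj_scalars (lsgen N Omega0) zeta (fun=> m.+1).
  apply: eigen_conj_scalars => // [j|]; last by rewrite sum_nat_const card_ord dimN; lia.
  rewrite rkN; have := rank_eigenspace_conj_scalars j F0.
  have := rank_eigenspace_conj_scalars j G0; nia.
set mult := fun j : 'I_k.+2 => _.
(* Needed for the identity, to count dimensions, and for the square, in the rigidity inequality. *)
have sum_mult (f : nat -> nat) : (\sum_j f (mult j) = k * f m.+1 + f m + f 1)%N.
  rewrite !big_ord_recr /= /mult (eq_bigr (fun=> f m.+1)) => [|i _];
    last by rewrite /= ltn_ord.
  by rewrite sum_nat_const card_ord /= ltnn eqxx ltnNge leqnSn /= gtn_eqF.
(* The first [k] eigenvalues occur in both [F] and [G], the next one comes from [F] and the last one
   from [G]. *)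
have Noo : conj_scalars (lsgen N Omegaoo) xi mult.
  apply: eigen_conj_scalars => // [j|]; last by rewrite (sum_mult id) dimN; lia.
  rewrite rkN /mult.
  have rkF (i : 'I_k.+1) := rank_eigenspace_conj_scalars i Foo.
  have rkG (i : 'I_k.+1) := rank_eigenspace_conj_scalars i Goo.
  case: ltnP => [jk|kj].
    have jk1 : (j < k.+1)%N by apply: ltnW.
    have := rkF (inord j); have := rkG (inord j).
    rewrite xiFE xiGE !inordK // jk inord_val; nia.
  case: eqVneq => [jk|jk].
    have jk1 : (j < k.+1)%N by rewrite jk.
    have := rkF (inord j); rewrite xiFE !inordK // inord_val; nia.
  have jm : j = ord_max by apply: val_inj => /=; have := ltn_ord j; lia.
  have := rkG ord_max; rewrite xiGE /= ltnn jm; nia.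
pose q : 'rV[K]_m.+1 := \row_j (lambda j - eta1).
have [u BE] := prod_jp_mx lambda eta10.
have detB : \det (\prod_i jp_mx lambda eta1 i) = eta1 ^+ m * eta2.
  rewrite -prodE (big_morph _ (@det_mulmx K m.+1) (det1 _ _)).
  by apply: eq_bigr => i _; apply: det_jp_mx.
have q0 : q != 0.
  by apply/eqP => /rowP/(_ 0)/eqP; rewrite !mxE subr_eq0 (negPf (lamE _)).
rewrite BE in detB; have csB := rank_one_update_conj_scalars eta10 eta12 q0 detB.
rewrite -BE in csB.
have B1 : \prod_i jp_mx lambda eta1 i - 1%:M \in unitmx.
  rewrite -[\prod_i _]expr1; apply: conj_scalarsX_unit csB _ => j; rewrite expr1.
  by rewrite /pair_fun; case: ifP.
(* The middle matrix of [N]. It has the eigenvalues and multiplicities of the Jordan-Pochhammer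
   product, so the latter may replace it. *)
pose D : 'M[K]_(m + 1) := block_mx eta1%:M 0 0 eta2%:M.
have rkD1 : (m <= \rank (eigenspace D eta1))%N.
  by rewrite rank_eigenspace_block /eigenspace subrr mxrank_ker mxrank0 subn0 leq_addr.
have rkD2 : (0 < \rank (eigenspace D eta2))%N.
  by rewrite rank_eigenspace_block /eigenspace subrr [X in (_ + X)%N]mxrank_ker mxrank0
    addn1.
have csD := conj_scalars_pair eta12 (addn1 m) rkD1 rkD2.
have [S [T [ST TS SD]]] := conj_scalars_similar csD csB.
have [P [Q [QP NA]]] := has_factorization_similar ST TS SD
  (has_factorization_lsadd (has_factorization_lsmuln m Ff) Gf).
pose A i := 1%:M + P *m (jp_mx lambda eta1 i - 1%:M) *m Q.
have prodA : \prod_i A i = lsgen N (Alpha 0) by rewrite prod_factorization // NA.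
have AU i : A i \in unitmx.
  by rewrite unitmxE /A -mulmxA det_1D_mulC -mulmxA QP mulmx1 addrC subrK det_jp_mx unitfE.
have [relN N0k] := complement_relations Nd; rewrite big_ord1 -prodA in relN.
pose L := complement_locsys (n := n) (s := s) AU (lsgen_unit N Omega0) (lsgen_unit N
  Omegaoo)
  eps0 relN N0k (conj_scalarsX Noo xn).
exists L; split.
  apply: (@rigid_pochhammer_of_factorization _ _ _ _ _ _ L P Q (jp_mx lambda eta1) eps
    lambda zeta) => //.
  - by move=> i; apply: rank_jp_mx.
  - by move=> i; apply: det_jp_mx.
  - by move=> U; apply: jp_mx_irreducible.
  (* The right side exceeds the left by exactly [2]. *)
  - by rewrite (sum_mult (fun a => a * a)%N); nia.
exists 1%:M, 1%:M; split; rewrite ?mulmx1 //; apply: intertwine_gen => x.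
rewrite mul1mx mulmx1; case: x => [i|||] //.
by rewrite (ord1 i) -prodA; apply: (weval_prod (lsgen L) _ (fun i => WGen (Alpha i))).
Qed.

End Main.

(* xi_i is xi (i - 1); in particular xi_k is xi (inord k.-1) and xi_(k+1) is
   xi ord_max. *)
Theorem theorem7p2 (R : realType) (n k ell : nat) (r s : int)
  (hk : (0 < k)%N) (hkn : (k < n)%N) (hcop : coprime n k) (hell : (0 < ell)%N)
  (hrs : r * n%:Z = k%:Z * s + 1)
  (eps : R[i]) (lambda : 'I_ell -> R[i]) (xi : 'I_k.+1 -> R[i])
  (eps_neq0 : eps != 0)
  (lambda_neq0 : forall i, lambda i != 0)
  (xi_neq0 : forall j, xi j != 0)
  (eta1 eta2 : R[i])
  (eta1E : eta1 = (-1) ^+ k.-1 * eps ^ r *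
                  \prod_(j < k.+1 | (j < k)%N) (xi j)^-1)
  (eta2E : eta2 = (-1) ^+ k.-1 * eps ^ r * (xi ord_max)^-1 *
                  \prod_(j < k.+1 | (j < k.-1)%N) (xi j)^-1)
  (lambda_neq1 : forall i, lambda i != 1)
  (eta1_neq1 : eta1 != 1)
  (eta2_neq1 : eta2 != 1)
  (lambda_neq_eta1 : forall i, lambda i != eta1)
  (xi_distinct : forall i j : 'I_k.+1, i != j -> xi i != xi j)
  (sum1_neq0 : \sum_(j < k.+1 | (j < k)%N) xi j != 0)
  (sum2_neq0 : (\sum_(j < k.+1 | (j < k.-1)%N) xi j) + xi ord_max != 0)
  (xi_k : forall j, xi j ^+ k != eps ^ r)
  (prod_rel : (\prod_(i < ell) lambda i) *
              (\prod_(j < k.+1 | (j < k.-1)%N) xi j ^+ ell) *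
              xi (inord k.-1) ^+ ell.-1 * xi ord_max =
              (-1) ^+ (k.-1 * ell) * eps ^ (r * ell%:Z))
  (xi_n : forall j, xi j ^+ n = eps ^ s) :
  exists (L : locsys R[i] (pi1_complement n k ell r s))
         (F G : locsys R[i] (pi1_complement n k 1 r s)),
  [/\ [/\ local_data L eps lambda xi
            (fun j : 'I_k.+1 => if (j < k.-1)%N then ell
                                else if (j == k.-1 :> nat) then ell.-1
                                else 1%N),
          ls_irreducible L, ls_rigid L, pochhammer L & multiplicity_one L],
      (let xiF := fun j : 'I_k => xi (widen_ord (leqnSn k) j) in
       [/\ [/\ local_data F eps (fun=> eta1) xiF (fun=> 1%N),
               ls_irreducible F, ls_rigid F, pochhammer F & multiplicity_one F] &
           forall F' : locsys R[i] (pi1_complement n k 1 r s),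
             local_data F' eps (fun=> eta1) xiF (fun=> 1%N) -> isols F' F]),
      (let xiG := fun j : 'I_k => if (j == k.-1 :> nat) then xi ord_max
                                  else xi (widen_ord (leqnSn k) j) in
       [/\ [/\ local_data G eps (fun=> eta2) xiG (fun=> 1%N),
               ls_irreducible G, ls_rigid G, pochhammer G & multiplicity_one G] &
           forall G' : locsys R[i] (pi1_complement n k 1 r s),
             local_data G' eps (fun=> eta2) xiG (fun=> 1%N) -> isols G' G])
    & isols (ls_restrict (fat_hom n k ell r s) L)
            (lsadd (lsmuln F ell.-1) G)].
Proof.
destruct k as [|k]; first by [].
destruct ell as [|m]; first by [].
have c0 : eps ^ r != 0 by rewrite expfz_neq0.
have [zeta zinj zk] := exists_roots (ltn0Sn k) c0.
have xi_inj : injective xi by move=> i j /eqP; apply: contraTeq => /xi_distinct.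
set xiF := fun j : 'I_k.+1 => xi (widen_ord (leqnSn k.+1) j).
set xiG := fun j : 'I_k.+1 => if j == k :> nat then xi ord_max
                               else xi (widen_ord (leqnSn k.+1) j).
have xiF_inj : injective xiF.
  by move=> i j /xi_inj/(congr1 val) /= ij; apply: val_inj.
have xiG_inj : injective xiG.
  move=> i j; rewrite /xiG; case: eqP => ik; case: eqP => jk.
  - by move=> _; apply: val_inj; rewrite /= ik jk.
  - by move=> /xi_inj/(congr1 val) /= ij; have := ltn_ord j; rewrite -ij ltnn.
  - by move=> /xi_inj/(congr1 val) /= ij; have := ltn_ord i; rewrite ij ltnn.
  - by move=> /xi_inj/(congr1 val) /= ij; apply: val_inj.
pose p := \prod_(j < k) xi (widen_ord (leqW (leqnSn k)) j).
have prodF : \prod_j xiF j = p * xi (inord k).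
  rewrite big_ord_recr /=; congr (_ * xi _); last by apply: val_inj; rewrite /= inordK.
  by apply: eq_bigr => j _; congr xi; apply: val_inj.
have prodG : \prod_j xiG j = p * xi ord_max.
  rewrite big_ord_recr /= /xiG eqxx; congr (_ * _).
  by apply: eq_bigr => j _; rewrite /= ltn_eqF //; congr xi; apply: val_inj.
have p0 : p != 0 by apply/prodf_neq0.
have prod_zeta := prod_roots (ltn0Sn k) zinj zk.
(* [eta1] and [eta2] are the quotients of the determinants of [omega_0] and [omega_oo] on [F] and
   [G]; the sign is that of the product of the roots of ['X^k - c]. *)
have eta1F : eta1 = \prod_j zeta j / \prod_j xiF j.
  by rewrite eta1E (big_ord_narrow (leqnSn k.+1)) prodfV prod_zeta.
have eta2G : eta2 = \prod_j zeta j / \prod_j xiG j.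
  rewrite eta2E (big_ord_narrow (leqW (leqnSn k))) prodfV prod_zeta prodG -/p.
  by rewrite invfM mulrA mulrAC.
have N0 : \prod_j zeta j != 0 by rewrite prod_zeta mulf_neq0 // signr_eq0.
rewrite prodF in eta1F; rewrite prodG in eta2G.
have eta12 : eta1 != eta2.
  rewrite eta1F eta2G; apply/eqP => /(mulfI N0)/invr_inj/(mulfI p0)/xi_inj/(congr1 val).
  by rewrite /= inordK // => /n_Sn.
have eta10 : eta1 != 0 by rewrite eta1F !mulf_neq0 ?invr_eq0 ?mulf_neq0.
(* Multiplied by the product of the eigenvalues of [omega_oo], with multiplicity, both sides become
   [(\prod_j zeta j) ^+ m.+1], the left one by [prod_rel]. *)
have prod_lambda : \prod_i lambda i = eta1 ^+ m * eta2.
  move: prod_rel; rewrite (big_ord_narrow (leqW (leqnSn k))) prodrXl -/p /=.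
  rewrite -exprz_exp -exprnP exprM -exprMn => rel_lambda.
  have : (\prod_i lambda i) * (p ^+ m.+1 * xi (inord k) ^+ m * xi ord_max) =
         eta1 ^+ m * eta2 * (p ^+ m.+1 * xi (inord k) ^+ m * xi ord_max).
    rewrite !mulrA rel_lambda -prod_zeta eta1F eta2G expr_div_n exprMn !exprSr.
    by field; rewrite !expf_neq0 // !xi_neq0 p0.
  by apply: mulIf; rewrite !mulf_neq0 ?expf_neq0.
rewrite -prodF in eta1F; rewrite -prodG in eta2G.
have [F [FP F0 Ff]] := exists_rigid_pochhammer_1 (n := n) (s := s) (ltn0Sn k) eps_neq0
  zinj zk xiF_inj
  (fun j => xi_k _) (fun j => xi_neq0 _) (fun j => xi_n _) eta1F eta1_neq1.
have xiGP (P : pred R[i]) : (forall j, P (xi j)) -> forall j, P (xiG j).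
  by move=> Pxi j; rewrite /xiG; case: ifP.
have [G [GP G0 Gf]] := exists_rigid_pochhammer_1 (n := n) (s := s) (ltn0Sn k) eps_neq0
  zinj zk xiG_inj
  (xiGP [pred x | x ^+ k.+1 != eps ^ r] xi_k) (xiGP [pred x | x != 0] xi_neq0)
  (fun j => eqP (xiGP [pred x | x ^+ n == eps ^ s] (fun i => introT eqP (xi_n i)) j))
    eta2G eta2_neq1.
have [dataF _ rigF _ _] := FP; have [dataG _ rigG _ _] := GP.
have [[Fd _ _ _ Foo] [Gd _ _ _ Goo]] := (dataF, dataG).
have xiFE (j : 'I_k.+1) : xiF j = xi (inord j).
  by congr xi; apply: val_inj; rewrite /= inordK // ltnS ltnW.
have xiGE (j : 'I_k.+1) : xiG j = if (j < k)%N then xi (inord j) else xi ord_max.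
  rewrite -xiFE /xiG ltn_neqAle -ltnS ltn_ord andbT; by case: eqP.
have [L [LP Lfat]] := exists_rigid_pochhammer eps_neq0 eta10 zinj zk xi_inj xi_k xi_n
  lambda_neq0 lambda_neq1 lambda_neq_eta1 eta1_neq1 eta2_neq1 eta12 prod_lambda xiFE xiGE
  F0 G0 Foo Goo Fd Gd Ff Gf.
exists L, F, G; split; [exact: LP | | | exact: Lfat].
  by split=> [|F']; [exact: FP | apply: isols_of_local_data].
by split=> [|G']; [exact: GP | apply: isols_of_local_data].
Qed.
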